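(* Let $m\ge1$ be an integer, let $\Lambda=\{-m,\ldots,0,\ldots,m\}$, and let $f_m$ be a random real Laurent polynomial with spectrum $\Lambda$ (a random real Laurent polynomial of degree $m$). Then: (a) The expected number of real roots of $f_m$ equals $2\sqrt{\frac{m(m+1)}{3}}$. (b) The probability $\mathcal P(f_m)$ that a root of $f_m$ is real equals $\sqrt{\frac{m+1}{3m}}$. (c) $\lim_{m\to\infty}\mathcal P(f_m)=\frac{1}{\sqrt3}$.
   Context: A Laurent polynomial with spectrum $\Lambda$ (a finite subset of $\mathbb{Z}$) is a function $P(z)=\sum_{k\in\Lambda}a_kz^k$ on $\mathbb{C}\setminus\{0\}$. It is called real if its restriction to the unit circle $S\subset\mathbb{C}$ is real-valued. A real root is a root lying on $S$. Restriction to $S$ identifies real Laurent polynomials with spectrum $\Lambda=\{-m,\dots,m\}$ with the real vector space ${\rm Trig}(\Lambda)$ of functions $\sum_{k\in\Lambda}(\alpha_k\cos(k\theta)+\beta_k\sin(k\theta))$, $\alpha_k,\beta_k\in\mathbb{R}$, equipped with the inner product $(f,g)=\int_S f(\theta)g(\theta)\,d\theta$. A random real Laurent polynomial with spectrum $\Lambda$ is a random element of ${\rm Trig}(\Lambda)$ distributed according to the standard (centered) Gaussian measure of this Euclidean space. The probability $\mathcal P(f_m)$ that a root is real is the expectation of the ratio (number of real roots of $f_m$)/(number of roots of $f_m$ in $\mathbb{C}\setminus\{0\}$, counted with multiplicity); the denominator is almost surely $2m$. *)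

(* Defs.v *)
From HB Require Import structures.
From mathcomp Require Import all_boot all_order all_algebra.
From mathcomp Require Import all_classical all_reals all_analysis.
From mathcomp Require Import complex.

Set Implicit Arguments.
Unset Strict Implicit.
Unset Printing Implicit Defensive.

Import Order.TTheory GRing.Theory Num.Theory.
Import numFieldNormedType.Exports.

Local Open Scope classical_set_scope.
Local Open Scope ring_scope.
Local Open Scope complex_scope.

(* The spectrum {-m, ..., m} is indexed by j < 2m+1, with k = j - m. *)
Definition freq (m : nat) (j : 'I_(m.*2.+1)) : int := j%:Z - m%:Z.

(* Laurent polynomials with spectrum {-m, ..., m}, given by their
   coefficients: a j is the coefficient of z ^ (freq j). *)
Definition laurent (R : realType) (m : nat) : Type := 'I_(m.*2.+1) -> R[i].

Definition laurent_eval (R : realType) (m : nat) (a : laurent R m) (z : R[i])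
  : R[i] := \sum_(j < m.*2.+1) a j * z ^ freq j.

Definition unit_circle (R : realType) : set R[i] := [set z | `|z| = 1].

Definition real_laurent (R : realType) (m : nat) (a : laurent R m) : Prop :=
  forall z : R[i], unit_circle z -> laurent_eval a z \is Num.real.

Definition restr_circle (R : realType) (m : nat) (a : laurent R m) (theta : R)
  : R := complex.Re (laurent_eval a (cos theta +i* sin theta)).

Definition laurent_roots (R : realType) (m : nat) (a : laurent R m) : set R[i] :=
  [set z | z != 0 /\ laurent_eval a z = 0].

Definition real_roots (R : realType) (m : nat) (a : laurent R m) : set R[i] :=
  laurent_roots a `&` @unit_circle R.

(* The polynomial z ^ m * P(z); at z != 0 it vanishes to the same order as P. *)
Definition laurent_poly (R : realType) (m : nat) (a : laurent R m)
  : {poly R[i]} := \sum_(j < m.*2.+1) a j *: 'X^j.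

Definition nb_real_roots (R : realType) (m : nat) (a : laurent R m) : \bar R :=
  counting (real_roots a).

(* Number of roots in C \ {0}, counted with multiplicity (0 if a = 0). *)
Definition nb_roots (R : realType) (m : nat) (a : laurent R m) : nat :=
  (\sum_(z \in laurent_roots a) mup z (laurent_poly a))%N.

(* Equal to 0 when there is no root or when a = 0, which are null events for
   a random real Laurent polynomial of degree m >= 1. *)
Definition real_root_ratio (R : realType) (m : nat) (a : laurent R m) : R :=
  fine (nb_real_roots a) / (nb_roots a)%:R.

Definition Trig (R : realType) (m : nat) : set (R -> R) :=
  [set f | exists alpha beta : 'I_(m.*2.+1) -> R, f = fun theta =>
    \sum_(j < m.*2.+1) (alpha j * cos ((freq j)%:~R * theta)
                        + beta j * sin ((freq j)%:~R * theta))].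

Definition inner (R : realType) (f g : R -> R) : R :=
  \int[@lebesgue_measure R]_(theta in `[0, 2 * pi]) (f theta * g theta).

Definition orthonormal_basis (R : realType) (V : set (R -> R)) (n : nat)
    (e : 'I_n -> R -> R) : Prop :=
  [/\ forall i, V (e i),
      forall i j, inner (e i) (e j) = (i == j)%:R &
      forall f, V f -> exists c : 'I_n -> R,
        f = fun theta => \sum_(i < n) c i * e i theta].

(* Taking some of the B i to be setT gives the product rule for every
   subfamily. *)
Definition mutually_independent (d : measure_display) (T : measurableType d)
    (R : realType) (P : probability T R) (n : nat)
    (X : 'I_n -> {RV P >-> R}) : Prop :=
  forall B : 'I_n -> set R, (forall i, measurable (B i)) ->
    P (\bigcap_(i in [set: 'I_n]) (X i @^-1` B i))
    = (\prod_(i < n) P (X i @^-1` B i))%E.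

(* G is distributed according to the standard Gaussian measure of the
   finite-dimensional space V with inner product inner: this measure is the
   image of the standard Gaussian measure of R^n under the isometry
   x |-> \sum_i x_i e_i given by an orthonormal basis e of V. *)
Definition standard_gaussian (d : measure_display) (T : measurableType d)
    (R : realType) (P : probability T R) (V : set (R -> R)) (G : T -> R -> R)
  : Prop :=
  exists (n : nat) (e : 'I_n -> R -> R) (xi : 'I_n -> {RV P >-> R}),
  [/\ orthonormal_basis V e,
      mutually_independent xi,
      forall i (A : set R), measurable A ->
        distribution P (xi i) A = normal_prob 0 1 A &
      forall w theta, G w theta = \sum_(i < n) xi i w * e i theta].

Definition random_real_laurent (d : measure_display) (T : measurableType d)
    (R : realType) (P : probability T R) (m : nat) (F : T -> laurent R m)
  : Prop :=
  (forall w, real_laurent (F w)) /\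
  standard_gaussian P (Trig m) (fun w => restr_circle (F w)).

Definition expected_nb_real_roots (d : measure_display) (T : measurableType d)
    (R : realType) (P : probability T R) (m : nat) (F : T -> laurent R m)
  : \bar R := (\int[P]_w nb_real_roots (F w))%E.

Definition real_root_probability (d : measure_display) (T : measurableType d)
    (R : realType) (P : probability T R) (m : nat) (F : T -> laurent R m)
  : \bar R := ('E_P[fun w => real_root_ratio (F w)])%E.

(* Main.v *)
(* The number of real roots is the number of zeros of the trigonometric
    polynomial f on [0, 2 pi[.  Almost surely all these zeros are simple (a
    Bulinskaya argument), so their number is the limit, as n tends to infinity,
    of the number of sign changes of f along the regular grid of n points, and
    it dominates the latter.  The covariance of f is the Dirichlet kernel
    (the reproducing kernel of the space), so two consecutive values of f have
    correlation rho(2 pi / n), where rho is the normalised Dirichlet kernel.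
    By Sheppard's formula they have opposite signs with probability
    arccos (rho (2 pi / n)) / pi.  By dominated convergence the expected number
    of zeros is the limit of n arccos (rho (2 pi / n)) / pi, which is
    2 sqrt (- rho''(0)) = 2 sqrt (m (m + 1) / 3).  Almost surely the two extreme
    coefficients do not vanish, and then there are 2 m roots in all. *)

Require Import Defs.
From HB Require Import structures.
From mathcomp Require Import all_boot all_order all_algebra finmap.
From mathcomp Require Import all_classical all_reals all_analysis.
From mathcomp Require Import measurable_realfun complex ring lra.

Set Implicit Arguments.
Unset Strict Implicit.
Unset Printing Implicit Defensive.

Import Order.TTheory GRing.Theory Num.Theory.
Import numFieldNormedType.Exports.

Local Open Scope classical_set_scope.
Local Open Scope ring_scope.

(** * Gaussian measure in the plane *)

(** The hypotheses give one-dimensional laws and a product rule for boxes, whereas sign changes need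
    the joint law of two values of [f]. No density of a vector is written down: the [xi i] are added
    one at a time, and after each addition rotations bring the pair of sums back to a triangular
    image of two independent standard normal variables. Rotation invariance also yields Sheppard's
    formula without an angular integral, because the probability of opposite signs is additive in
    the angle. Only covariances enter, and the kernel gives them for every orthonormal basis at
    once. Double zeros are excluded by combining a bound on [f''] for each sample with a small-ball
    estimate at the grid points. The grid also settles measurability: on an event of full measure
    the root count is a limit of measurable counts, all bounded by [2 m]. The limit in [n] uses no
    second-order expansion: [1 - rho(h)] is twice the mean of [sin (k h / 2) ^ 2] over the spectrum,
    and the mean of [k ^ 2] is [m (m + 1) / 3]. *)

Section normal_density.
Context {R : realType}.
Notation mu := (@lebesgue_measure R).
Notation gamma := (@normal_prob R 0 1).
Notation phi := (@normal_pdf R 0 1).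

(** The image of Lebesgue measure under a translation gives every half-open interval its own length,
    so uniqueness identifies the two measures. *)
Lemma ge0_integral_translate (f : R -> \bar R) (a : R) :
  measurable_fun [set: R] f -> (forall x, 0 <= f x)%E ->
  (\int[mu]_x f (x + a)%R = \int[mu]_x f x)%E.
Proof.
move=> mf f0.
pose T : measurableTypeR R -> measurableTypeR R := fun x => x + a.
have mT : measurable_fun setT T by exact: measurable_funD.
transitivity (\int[pushforward mu T]_x f x)%E.
  by rewrite ge0_integral_pushforward.
apply: eq_measure_integral => A mA _; apply/esym.
apply: lebesgue_measure_unique => // X /ocitvP[->|[[u v] /= uv ->]].
  by rewrite !measure0.
rewrite /= /pushforward.
have -> : T @^-1` `]u, v]%classic = `]u - a, v - a]%classic.
  by apply/seteqP; split => x /=; rewrite /T !in_itv/= ltrBlDr lerBrDr.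
rewrite !lebesgue_measure_itv/= !lte_fin uv ltrD2r uv.
by rewrite -!EFinD; congr EFin; lra.
Qed.

(** [phi] agrees almost everywhere with the Radon-Nikodym derivative, since both have the same
    integral over every measurable set. *)
Lemma ge0_integral_gauss (f : R -> \bar R) :
  measurable_fun [set: R] f -> (forall x, 0 <= f x)%E ->
  (\int[gamma]_x f x = \int[mu]_x (f x * (phi x)%:E))%E.
Proof.
move=> mf f0.
have dom := @normal_prob_dominates R 0 1.
rewrite -(Radon_Nikodym_SigmaFinite.change_of_variables dom)//.
have mphi : measurable_fun [set: R] (fun x => (phi x)%:E).
  by apply/measurable_EFinP; exact: measurable_normal_pdf.
have iRN := Radon_Nikodym_SigmaFinite.f_integrable dom.
apply: ae_eq_integral => //=.
- by apply: emeasurable_funM => //; exact: (measurable_int mu).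
- exact: emeasurable_funM.
- apply: ae_eqe_mul2l; apply: integral_ae_eq => //.
  by move=> A _ mA; rewrite -Radon_Nikodym_SigmaFinite.f_integral.
Qed.

End normal_density.

(** * Invariance of plane measures under rotations *)

Section rotation_invariance.
Context {R : realType}.
Variable m : {sigma_finite_measure set R -> \bar R}.
Hypothesis m_translate : forall (f : R -> \bar R) (a : R),
  measurable_fun [set: R] f -> (forall x, 0 <= f x)%E ->
  (\int[m]_x f (x + a)%R = \int[m]_x f x)%E.

Let shearx (t : R) (p : R * R) : R * R := (p.1 + t * p.2, p.2).
Let sheary (t : R) (p : R * R) : R * R := (p.1, p.2 + t * p.1).

Let measurable_shearx t : measurable_fun [set: R * R] (shearx t).
Proof.
apply: measurable_fun_pair => //=; apply: measurable_funD => //.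
exact: measurable_funM.
Qed.

Let measurable_sheary t : measurable_fun [set: R * R] (sheary t).
Proof.
apply: measurable_fun_pair => //=; apply: measurable_funD => //.
exact: measurable_funM.
Qed.

Let integral_shearx t (f : R * R -> \bar R) :
  measurable_fun [set: R * R] f -> (forall x, 0 <= f x)%E ->
  (\int[m \x m]_p f (shearx t p) = \int[m \x m]_p f p)%E.
Proof.
move=> mf f0.
rewrite fubini_tonelli2//; last exact: (measurableT_comp mf (measurable_shearx t)).
rewrite (fubini_tonelli2 f mf f0); apply: eq_integral => y _; rewrite /fubini_G/=.
apply: (@m_translate (fun x => f (x, y)) (t * y)) => //.
exact: (measurableT_comp mf (measurable_pair2 y)).
Qed.

Let integral_sheary t (f : R * R -> \bar R) :
  measurable_fun [set: R * R] f -> (forall x, 0 <= f x)%E ->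
  (\int[m \x m]_p f (sheary t p) = \int[m \x m]_p f p)%E.
Proof.
move=> mf f0.
rewrite fubini_tonelli1//; last exact: (measurableT_comp mf (measurable_sheary t)).
rewrite (fubini_tonelli1 f mf f0); apply: eq_integral => x _; rewrite /fubini_F/=.
apply: (@m_translate (fun y => f (x, y)) (t * x)) => //.
exact: (measurableT_comp mf (measurable_pair1 x)).
Qed.

Definition rot (c s : R) (p : R * R) : R * R :=
  (c * p.1 - s * p.2, s * p.1 + c * p.2).

Lemma measurable_rot c s : measurable_fun [set: R * R] (rot c s).
Proof.
apply: measurable_fun_pair => /=.
  by apply: measurable_funB; exact: measurable_funM.
by apply: measurable_funD; exact: measurable_funM.
Qed.

(* A plane rotation is a product of three shears, and a shear preserves
   Lebesgue measure by Fubini and translation invariance. *)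
Lemma integral_rot c s (f : R * R -> \bar R) :
  c ^+ 2 + s ^+ 2 = 1 -> c != -1 ->
  measurable_fun [set: R * R] f -> (forall x, 0 <= f x)%E ->
  (\int[m \x m]_p f (rot c s p) = \int[m \x m]_p f p)%E.
Proof.
(* For [c = cos x] and [s = sin x], [t] is [- tan (x / 2)]. The half-turn [c = -1] is the one
   rotation that this factorisation misses. *)
move=> cs1 cN1 mf f0; pose t := - (s / (1 + c)).
have c1 : 1 + c != 0 by apply: contra cN1; rewrite addrC addr_eq0.
have rotE p : rot c s p = shearx t (sheary s (shearx t p)).
  have st : 1 + s * t = c.
    have s2 : s * s = (1 - c) * (1 + c).
      by rewrite -expr2 -[_ ^+ 2](addKr (c ^+ 2)) cs1; ring.
    by rewrite /t mulrN mulrA s2 mulfK//; ring.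
  have tt : t + t * c = - s by rewrite /t; field.
  rewrite /rot /shearx /sheary/=; congr pair.
    by rewrite -mulNr -tt -st; ring.
  by rewrite -st; ring.
under eq_integral do rewrite rotE.
rewrite (@integral_shearx t (fun p => f (shearx t (sheary s p))))//; last first.
  by apply: measurableT_comp => //; exact: measurableT_comp.
rewrite (@integral_sheary s (fun p => f (shearx t p)))//.
  exact: integral_shearx.
exact: measurableT_comp.
Qed.

Variables (g : probability R R) (phi : R -> R).
Hypothesis mphi : measurable_fun [set: R] phi.
Hypothesis phi_ge0 : forall x, 0 <= phi x.
Hypothesis g_density : forall f : R -> \bar R,
  measurable_fun [set: R] f -> (forall x, 0 <= f x)%E ->
  (\int[g]_x f x = \int[m]_x (f x * (phi x)%:E))%E.

Lemma integral_density2 (f : R * R -> \bar R) :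
  measurable_fun [set: R * R] f -> (forall x, 0 <= f x)%E ->
  (\int[g \x g]_p f p =
   \int[m \x m]_p (f p * (phi p.1 * phi p.2)%:E))%E.
Proof.
move=> mf f0.
have mphiE : measurable_fun [set: R] (fun x => (phi x)%:E) by exact/measurable_EFinP.
have mg : measurable_fun [set: R * R] (fun p => f p * (phi p.1 * phi p.2)%:E)%E.
  apply: emeasurable_funM => //; apply/measurable_EFinP/measurable_funM;
    by apply: measurableT_comp => //; exact: mphi.
have g0 p : (0 <= f p * (phi p.1 * phi p.2)%:E)%E.
  by rewrite mule_ge0// lee_fin mulr_ge0// phi_ge0.
rewrite fubini_tonelli1// [RHS]fubini_tonelli1// g_density; last 2 first.
- exact: measurable_fun_fubini_tonelli_F.
- by move=> x; exact: integral_ge0.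
apply: eq_integral => x _; rewrite /fubini_F g_density//=; last first.
  exact: measurableT_comp.
rewrite -ge0_integralZr//.
- by apply: eq_integral => y _; rewrite EFinM muleAC muleA.
- by apply: emeasurable_funM => //; exact: measurableT_comp.
- by move=> y _; rewrite mule_ge0// lee_fin phi_ge0.
- by rewrite lee_fin phi_ge0.
Qed.

Hypothesis phi_rot : forall c s p, c ^+ 2 + s ^+ 2 = 1 ->
  phi (rot c s p).1 * phi (rot c s p).2 = phi p.1 * phi p.2.

Lemma integral_density2_rot c s (f : R * R -> \bar R) :
  c ^+ 2 + s ^+ 2 = 1 -> c != -1 ->
  measurable_fun [set: R * R] f -> (forall x, 0 <= f x)%E ->
  (\int[g \x g]_p f (rot c s p) = \int[g \x g]_p f p)%E.
Proof.
move=> cs1 cN1 mf f0.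
rewrite !integral_density2//; last by apply: measurableT_comp => //; exact: measurable_rot.
rewrite -[RHS](integral_rot cs1 cN1)//.
- apply: eq_integral => p _; congr (_ * _%:E)%E.
  exact/esym/phi_rot.
- apply: emeasurable_funM => //; apply/measurable_EFinP/measurable_funM;
    by apply: measurableT_comp => //; exact: mphi.
- by move=> p; rewrite mule_ge0// lee_fin mulr_ge0// phi_ge0.
Qed.

End rotation_invariance.

Section gauss2.
Context {R : realType}.

Let leb : set R -> \bar R := @lebesgue_measure R.

HB.instance Definition _ := isMeasure.Build _ R R leb
  (measure0 (@lebesgue_measure R)) (measure_ge0 (@lebesgue_measure R))
  (@measure_semi_sigma_additive _ _ _ (@lebesgue_measure R)).
HB.instance Definition _ := Measure_isSigmaFinite.Build _ R R leb
  (sigma_finiteT (@lebesgue_measure R)).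

(** The two measures take the same values and differ only in the measurable structure declared on
    the line; the identity map carries one integral to the other. *)
Let ge0_integral_display (m1 : {measure set (measurableTypeR R) -> \bar R})
    (m2 : {measure set R -> \bar R}) (f : R -> \bar R) :
  (forall A, m1 A = m2 A) ->
  measurable_fun [set: R] f -> (forall x, 0 <= f x)%E ->
  (\int[m1]_x f x = \int[m2]_x f x)%E.
Proof.
move=> m12 mf f0; pose i : measurableTypeR R -> R := idfun.
have mi : measurable_fun setT i by move=> _ A mA; rewrite setTI.
transitivity (\int[pushforward m1 i]_x f x)%E.
  by rewrite (ge0_integral_pushforward mi).
by apply: eq_measure_integral => A _ _; exact: m12.
Qed.

Definition gauss1 : set R -> \bar R := @normal_prob R 0 1.

HB.instance Definition _ := isMeasure.Build _ R R gauss1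
  (measure0 (@normal_prob R 0 1)) (measure_ge0 (@normal_prob R 0 1))
  (@measure_semi_sigma_additive _ _ _ (@normal_prob R 0 1)).
HB.instance Definition _ := Measure_isProbability.Build _ _ R gauss1
  (@probability_setT _ _ _ (@normal_prob R 0 1)).

(** The density never exceeds its peak [1 / sqrt (2 pi)], which is below 1. This gives both the
    absence of atoms and the small-ball estimates. *)
Lemma gauss1_le_lebesgue (A : set R) : measurable A ->
  (gauss1 A <= @lebesgue_measure R A)%E.
Proof.
move=> mA; rewrite -[leRHS]mul1e -integral_cst//.
have mphi : measurable_fun A (EFin \o @normal_pdf R 0 1).
  by apply/measurable_EFinP/measurable_funTS; exact: measurable_normal_pdf.
apply: ge0_le_integral => // x _; rewrite lee_fin ?normal_pdf_ge0//.
apply: (le_trans (normal_pdf_ub _ _ (oner_neq0 R))).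
have pi2 := @pi_ge2 R.
rewrite /normal_peak expr1n mul1r -mulr_natr invf_le1; last first.
  by rewrite sqrtr_gt0 mulr_gt0 ?pi_gt0.
by rewrite -[leLHS]sqrtr1 ler_sqrt; lra.
Qed.

Lemma gauss1_set1 (x : R) : gauss1 [set x] = 0%E.
Proof.
apply/eqP; rewrite eq_le measure_ge0 andbT.
by rewrite (le_trans (gauss1_le_lebesgue _))// lebesgue_measure_set1.
Qed.

Definition gauss2 : set (R * R) -> \bar R := (gauss1 \x gauss1)%E.

HB.instance Definition _ := Measure.copy gauss2 (gauss1 \x gauss1)%E.
HB.instance Definition _ := Measure_isProbability.Build _ _ R gauss2
  (@probability_setT _ _ _ (gauss1 \x gauss1)%E).

Lemma gauss2X (A B : set R) : measurable A -> measurable B ->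
  gauss2 (A `*` B) = (gauss1 A * gauss1 B)%E.
Proof. exact: product_measure1E. Qed.

Lemma gauss2_fubini1 (f : R * R -> \bar R) :
  measurable_fun [set: R * R] f -> (forall x, 0 <= f x)%E ->
  (\int[gauss2]_p f p = \int[gauss1]_x \int[gauss1]_y f (x, y))%E.
Proof. by move=> mf f0; rewrite [LHS](fubini_tonelli1 f mf f0). Qed.

Lemma gauss2_fubini2 (f : R * R -> \bar R) :
  measurable_fun [set: R * R] f -> (forall x, 0 <= f x)%E ->
  (\int[gauss2]_p f p = \int[gauss1]_y \int[gauss1]_x f (x, y))%E.
Proof. by move=> mf f0; rewrite [LHS](fubini_tonelli2 f mf f0). Qed.

Lemma gauss1E (A : set R) : gauss1 A = normal_prob 0 1 A.
Proof. by []. Qed.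

Lemma integral_gauss2_rot c s (f : R * R -> \bar R) :
  c ^+ 2 + s ^+ 2 = 1 -> c != -1 ->
  measurable_fun [set: R * R] f -> (forall x, 0 <= f x)%E ->
  (\int[gauss2]_p f (rot c s p) = \int[gauss2]_p f p)%E.
Proof.
apply: (@integral_density2_rot R leb _ gauss1 (@normal_pdf R 0 1)).
- move=> h a mh h0.
  rewrite -!(@ge0_integral_display (@lebesgue_measure R) leb)//.
    exact: ge0_integral_translate.
  apply: measurableT_comp => //; exact: measurable_funD.
- exact: measurable_normal_pdf.
- exact: normal_pdf_ge0.
- move=> h mh h0.
  rewrite -(@ge0_integral_display (@normal_prob R 0 1) gauss1)//.
  rewrite -(@ge0_integral_display (@lebesgue_measure R) leb)//.
  + exact: ge0_integral_gauss.
  + apply: emeasurable_funM => //; apply/measurable_EFinP.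
    exact: measurable_normal_pdf.
  + by move=> x; rewrite mule_ge0// lee_fin normal_pdf_ge0.
- move=> {}c {}s p cs1.
  rewrite !normal_pdfE ?oner_neq0// /normal_fun !subr0.
  rewrite mulrACA -expRD [RHS]mulrACA -expRD; congr (_ * expR _).
  rewrite -!mulrDl -!opprD; congr (- _ / _).
  rewrite -[RHS]mul1r -cs1 /rot/=; ring.
Qed.

Lemma gauss2_rot c s (D : set (R * R)) :
  c ^+ 2 + s ^+ 2 = 1 -> c != -1 -> measurable D ->
  gauss2 (rot c s @^-1` D) = gauss2 D.
Proof.
move=> cs1 cN1 mD.
have mrD : measurable (rot c s @^-1` D).
  by rewrite -[X in measurable X]setTI; exact: measurable_rot.
have indicE E : measurable E -> (\int[gauss2]_p (\1_E p)%:E = gauss2 E)%E.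
  by move=> mE; rewrite -[in RHS](setIT E); exact: integral_indic.
rewrite -(indicE _ mrD) -(indicE _ mD).
apply: (@integral_gauss2_rot c s (fun p => (\1_D p)%:E) cs1 cN1) => //.
by apply/measurable_EFinP; exact: measurable_indic.
Qed.

End gauss2.
Opaque gauss1 gauss2.

(** * Sheppard's formula *)

Section sheppard.
Context {R : realType}.
Notation gamma := (@gauss1 R).
Notation gamma2 := (@gauss2 R).

(** Scalar product of [p] with the unit vector of angle [a]. Under [gauss2], [ell a] and [ell b] are
    standard normal with correlation [cos (b - a)]. *)
Definition ell (a : R) (p : R * R) : R := cos a * p.1 + sin a * p.2.

Definition differ (a b : R) : set (R * R) := [set p | ell a p * ell b p < 0].

Lemma measurable_ell a : measurable_fun [set: R * R] (ell a).
Proof. by apply: measurable_funD; exact: measurable_funM. Qed.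

Lemma measurable_differ a b : measurable (differ a b).
Proof.
rewrite -[differ a b]setTI; apply: measurable_fun_ltr => //.
by apply: measurable_funM; exact: measurable_ell.
Qed.

Lemma ell_rot a b p : ell b (rot (cos a) (- sin a) p) = ell (a + b) p.
Proof. by rewrite /ell /rot/= cosD sinD; ring. Qed.

Lemma cos_neqN1 (a : R) : 0 <= a < pi -> cos a != -1.
Proof.
move=> /andP[a0 api]; rewrite -cospi; apply/eqP => /cos_inj.
rewrite !in_itv/= a0 (ltW api) pi_ge0 lexx => /(_ isT isT) E.
by rewrite E ltxx in api.
Qed.

Lemma gauss2_differD a b : 0 <= a < pi ->
  gamma2 (differ a (a + b)) = gamma2 (differ 0 b).
Proof.
move=> a0pi; rewrite -(@gauss2_rot R (cos a) (- sin a) (differ 0 b)).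
- congr (gamma2 _); apply/funext => p; rewrite /differ/= !ell_rot addr0//.
- by rewrite sqrrN cos2Dsin2.
- exact: cos_neqN1.
- exact: measurable_differ.
Qed.

(** A rotation takes the line to the vertical axis, which is null because [gauss1] has no atom. *)
Lemma gauss2_ell0 a : 0 <= a < pi -> gamma2 [set p | ell a p = 0] = 0%E.
Proof.
move=> a0pi.
have mX : measurable ([set (0 : R)] `*` [set: R]) by exact: measurableX.
transitivity (gamma2 (rot (cos a) (- sin a) @^-1` ([set (0 : R)] `*` [set: R]))).
  congr (gamma2 _); apply/seteqP.
  have e p : ell a p = (rot (cos a) (- sin a) p).1 by rewrite /ell /rot/=; ring.
  split=> [p h|p [h _]]; first by split => //; exact: etrans (esym (e p)) h.
  exact: etrans (e p) h.
rewrite (@gauss2_rot R (cos a) (- sin a) _ _ _ mX).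
- rewrite (gauss2X (measurable_set1 0) measurableT).
  by rewrite (gauss1_set1 0) mul0e.
- by rewrite sqrrN cos2Dsin2.
- exact: cos_neqN1.
Qed.

(** Up to the factor [S], the middle value [La] is a positive combination of [L0] and [Lb], so it
    cannot be on the other side when both lie on one side: along [L0], [La], [Lb] the sign changes
    add up. Each claim follows by multiplying the relation by one of the three values. [S = 0] must
    be allowed, since the two angles may add up to [pi]. *)
Lemma sign_combination (L0 La Lb A B S : R) : 0 < A -> 0 < B -> 0 <= S ->
  S * La = B * L0 + A * Lb ->
  [/\ L0 * La < 0 \/ La * Lb < 0 -> L0 * Lb < 0,
      La != 0 -> L0 * Lb < 0 -> L0 * La < 0 \/ La * Lb < 0 &
      L0 * La < 0 -> ~ La * Lb < 0].
Proof.
move=> A0 B0 S0 E; split.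
- case=> h.
  + have h2 : B * (L0 * L0) + A * (L0 * Lb) = S * (L0 * La).
      by rewrite [RHS]mulrCA E; ring.
    have h3 : S * (L0 * La) <= 0 by rewrite mulr_ge0_le0// ltW.
    have h4 : 0 < B * (L0 * L0).
      rewrite mulr_gt0// -expr2 exprn_even_gt0//=.
      by apply: contraTneq h => ->; rewrite mul0r ltxx.
    by rewrite -(pmulr_rlt0 _ A0); lra.
  + have h2 : B * (L0 * Lb) + A * (Lb * Lb) = S * (La * Lb).
      by rewrite [RHS]mulrA E; ring.
    have h3 : S * (La * Lb) <= 0 by rewrite mulr_ge0_le0// ltW.
    have h4 : 0 < A * (Lb * Lb).
      rewrite mulr_gt0// -expr2 exprn_even_gt0//=.
      by apply: contraTneq h => ->; rewrite mulr0 ltxx.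
    by rewrite -(pmulr_rlt0 _ B0); lra.
- move=> La0 h; have [?|h1] := ltP (L0 * La) 0; first by left.
  have [?|h2] := ltP (La * Lb) 0; first by right.
  have := mulr_ge0 h1 h2; have -> : L0 * La * (La * Lb) = La ^+ 2 * (L0 * Lb) by ring.
  by rewrite leNgt pmulr_rlt0 ?h// exprn_even_gt0.
- move=> h1 h2.
  have h3 : 0 <= S * La ^+ 2 by rewrite mulr_ge0// sqr_ge0.
  have h4 : S * La ^+ 2 = B * (L0 * La) + A * (La * Lb) by rewrite expr2 [LHS]mulrA E; ring.
  have : B * (L0 * La) < 0 by rewrite pmulr_rlt0.
  have : A * (La * Lb) < 0 by rewrite pmulr_rlt0.
  lra.
Qed.

(** Off the null line where [ell a] vanishes, [differ 0 (a + b)] is the disjoint union of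
    [differ 0 a] and [differ a (a + b)], and a rotation turns the latter into [differ 0 b]. *)
Lemma gauss2_differ_add a b : 0 < a -> 0 < b -> a + b <= pi ->
  gamma2 (differ 0 (a + b)) = (gamma2 (differ 0 a) + gamma2 (differ 0 b))%E.
Proof.
move=> a0 b0 abpi.
have a0pi : 0 <= a < pi by apply/andP; split; lra.
have sa : 0 < sin a by apply: sin_gt0_pi; apply/andP; split; lra.
have sb : 0 < sin b by apply: sin_gt0_pi; apply/andP; split; lra.
have sab : 0 <= sin (a + b) by apply: sin_ge0_pi; apply/andP; split; lra.
(* The linear relation between three unit vectors of the plane; the sines are the coefficients, and
   the angles make them nonnegative. *)
have id p : sin (a + b) * ell a p = sin b * ell 0 p + sin a * ell (a + b) p.
  have ca : cos a ^+ 2 = 1 - sin a ^+ 2 by exact: cos2sin2.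
  rewrite /ell cos0 sin0 cosD sinD; ring: ca.
pose Z := ell a @^-1` [set (0 : R)].
have mZ : measurable Z.
  by rewrite -[X in measurable X]setTI; exact: measurable_ell.
rewrite -(gauss2_differD b a0pi) -measureU; [|exact: measurable_differ|exact: measurable_differ|].
- transitivity (gamma2 (differ 0 (a + b) `\` Z) +
                gamma2 (differ 0 (a + b) `&` Z))%E.
    by apply: measureDI => //; exact: measurable_differ.
  rewrite [X in (_ + X)%E](_ : _ = 0%E) ?adde0; last first.
    apply: (subset_measure0 _ _ _ (gauss2_ell0 a0pi)) => //.
    by apply: measurableI => //; exact: measurable_differ.
  congr (gamma2 _); apply/seteqP; split => p; rewrite /differ/=.
  + move=> [h La0]; have [_ h2 _] := sign_combination sa sb sab (id p).
    by apply: h2 => //; exact/eqP.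
  + move=> h; have [h1 _ _] := sign_combination sa sb sab (id p).
    split; first exact: h1.
    by rewrite /Z/= => La0; case: h; rewrite La0 ?mulr0 ?mul0r ltxx.
- apply/seteqP; split => p //=; rewrite /differ/= => -[h1 h2].
  by have [_ _ /(_ h1 h2)] := sign_combination sa sb sab (id p).
Qed.

(** Opposite directions disagree off a null line; this value normalises the additive function of the
    angle. *)
Lemma gauss2_differ_pi : gamma2 (differ 0 pi) = 1%E.
Proof.
have p0 : 0 <= (0 : R) < pi by rewrite lexx pi_gt0.
rewrite (_ : differ 0 pi = ~` [set p | ell 0 p = 0]).
  rewrite probability_setC; last first.
    rewrite -[X in measurable X]setTI.
    exact: (measurable_ell 0 measurableT (measurable_set1 0)).
  rewrite [X in (_ - X)%E](gauss2_ell0 p0) sube0 //.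
apply/seteqP; split => p; rewrite /differ /ell/= cospi sinpi cos0 sin0.
  by rewrite !mul0r !addr0 mul1r => + p10; rewrite p10 mul0r ltxx.
rewrite !mul0r !addr0 mul1r mulN1r mulrN oppr_lt0 -expr2 => /eqP p10.
by rewrite exprn_even_gt0.
Qed.

Definition sheppard (a : R) : R := fine (gamma2 (differ 0 a)).

Let sheppardE a : gamma2 (differ 0 a) = (sheppard a)%:E.
Proof.
rewrite /sheppard fineK// ge0_fin_numE//.
by rewrite (le_lt_trans (probability_le1 _ _)) ?ltry//; exact: measurable_differ.
Qed.

Let sheppardD a b : 0 < a -> 0 < b -> a + b <= pi ->
  sheppard (a + b) = sheppard a + sheppard b.
Proof.
move=> a0 b0 ab; have := gauss2_differ_add a0 b0 ab.
by rewrite !sheppardE -EFinD => -[].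
Qed.

Let sheppard_ge0 a : 0 <= sheppard a.
Proof. by rewrite fine_ge0. Qed.

Let sheppard_le a b : 0 < a -> a <= b -> b <= pi -> sheppard a <= sheppard b.
Proof.
move=> a0; rewrite le_eqVlt => /predU1P[->//|ab] bpi.
by rewrite -(subrKC a b) sheppardD ?subr_gt0 ?lerDl// subrKC.
Qed.

Let sheppard_mul k x : 0 < x -> k.+1%:R * x <= pi ->
  sheppard (k.+1%:R * x) = k.+1%:R * sheppard x.
Proof.
move=> x0; elim: k => [_|k IH kpi]; first by rewrite !mul1r.
have kE y : k.+2%:R * y = k.+1%:R * y + y :> R.
  by rewrite -[k.+2]addn1 natrD mulrDl mul1r.
have k1pi : k.+1%:R * x <= pi.
  by apply: le_trans kpi; rewrite ler_pM2r// ler_nat.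
rewrite !kE sheppardD//; first by rewrite IH.
- by rewrite mulr_gt0.
- by rewrite -kE.
Qed.

Let sheppard_frac n k : (k < n)%N ->
  sheppard (k.+1%:R * (pi / n%:R)) = k.+1%:R / n%:R.
Proof.
move=> kn; have n0 : 0 < n%:R :> R by rewrite ltr0n (leq_trans _ kn).
have x0 : 0 < pi / n%:R :> R by rewrite divr_gt0// pi_gt0.
have nx : n%:R * (pi / n%:R) = pi :> R by rewrite mulrC divfK// gt_eqF.
have leqpi i : (i <= n)%N -> i%:R * (pi / n%:R) <= pi :> R.
  by move=> ni; rewrite -[leRHS]nx ler_pM2r// ler_nat.
rewrite sheppard_mul ?leqpi//; congr (_ * _).
case: n => // n in kn n0 x0 nx leqpi *.
have := sheppard_mul (k := n) x0 (leqpi _ (leqnn _)); rewrite nx.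
have -> : sheppard pi = 1 by rewrite /sheppard gauss2_differ_pi.
by move=> E; apply: (mulfI (lt0r_neq0 n0)); rewrite -E divff// gt_eqF.
Qed.

(* Sheppard's formula. The angle function is additive and monotone with value 1
   at pi, hence linear. *)
Lemma gauss2_differ a : 0 < a < pi -> gamma2 (differ 0 a) = (a / pi)%:E.
Proof.
move=> /andP[a0 api]; rewrite sheppardE; congr EFin; apply/eqP.
rewrite -subr_eq0 -normr_le0; apply/ler_addgt0Pr => e e0; rewrite add0r.
have pi0 := @pi_gt0 R.
(* Between the multiples [k] and [k + 1] of [pi / n] that enclose [a], both [sheppard a] and
   [a / pi] lie in [[k / n, (k + 1) / n]], an interval of length at most [e]. *)
have [n n0 ne] : exists2 n, 0 < n%:R :> R & n%:R^-1 <= e.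
  exists (Num.truncn e^-1).+1; first by rewrite ltr0n.
  rewrite -[leRHS]invrK lef_pV2 ?posrE ?invr_gt0//.
  by apply/ltW; rewrite truncnS_gt.
apply: le_trans ne.
have [k /andP[kx xk]] : exists k, k%:R <= a / pi * n%:R < k.+1%:R.
  exists (Num.truncn (a / pi * n%:R)); apply: truncn_itv.
  by rewrite mulr_ge0 ?divr_ge0// ltW.
have kn : (k < n)%N.
  rewrite -(ltr_nat R); apply: le_lt_trans kx _.
  by rewrite -[ltRHS]mul1r ltr_pM2r// ltr_pdivrMr// mul1r.
have aE : a = a / pi * n%:R * (pi / n%:R).
  have fieldE (p q : R) : p != 0 -> q != 0 -> a = a / p * q * (p / q).
    by move=> ? ?; field; apply/andP.
  by apply: fieldE; rewrite gt_eqF.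
have pn0 : 0 < pi / n%:R :> R by rewrite divr_gt0.
have up : sheppard a <= k.+1%:R / n%:R.
  rewrite -(sheppard_frac kn); apply: sheppard_le => //.
    by rewrite [leLHS]aE ler_pM2r// ltW.
  rewrite mulrCA -[leRHS]mulr1 ler_pM2l// ler_pdivrMr// mul1r ler_nat//.
have lo : k%:R / n%:R <= sheppard a.
  case: k kx kn {xk up} => [|k] kx kn; first by rewrite mul0r.
  rewrite -(sheppard_frac (ltnW kn)); apply: sheppard_le => //.
  - by rewrite mulr_gt0.
  - by rewrite [leRHS]aE ler_pM2r.
  - exact: ltW.
have aE2 : a / pi = a / pi * n%:R / n%:R by rewrite mulfK// gt_eqF.
have h1 : k%:R / n%:R <= a / pi by rewrite aE2 ler_pM2r ?invr_gt0.
have h2 : a / pi <= k.+1%:R / n%:R by rewrite aE2 ler_pM2r ?invr_gt0// ltW.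
have h3 : k.+1%:R / n%:R = k%:R / n%:R + n%:R^-1 :> R.
  by rewrite -addn1 natrD mulrDl mul1r.
by rewrite ler_norml; apply/andP; split; lra.
Qed.

End sheppard.

(** * Pairs of linear forms in independent Gaussian variables *)

Section gauss3.
Context {R : realType}.
Notation g1 := (@gauss1 R).
Notation g2 := (@gauss2 R).

Definition gauss3 : set (R * R * R) -> \bar R := (g2 \x g1)%E.

HB.instance Definition _ := Measure.copy gauss3 (g2 \x g1)%E.
HB.instance Definition _ := Measure_isProbability.Build _ _ R gauss3
  (@probability_setT _ _ _ (g2 \x g1)%E).

Definition rotxz (c s : R) (p : R * R * R) : R * R * R :=
  let q := rot c s (p.1.1, p.2) in (q.1, p.1.2, q.2).
Definition rotyz (c s : R) (p : R * R * R) : R * R * R :=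
  let q := rot c s (p.1.2, p.2) in (p.1.1, q.1, q.2).

Lemma measurable_rotxz c s : measurable_fun [set: R * R * R] (rotxz c s).
Proof.
have m : measurable_fun [set: R * R * R] (fun p => rot c s (p.1.1, p.2)).
  apply: measurableT_comp; first exact: measurable_rot.
  apply: measurable_fun_pair => //; exact: measurableT_comp.
apply: measurable_fun_pair; last exact: measurableT_comp.
by apply: measurable_fun_pair; exact: measurableT_comp.
Qed.

Lemma measurable_rotyz c s : measurable_fun [set: R * R * R] (rotyz c s).
Proof.
have m : measurable_fun [set: R * R * R] (fun p => rot c s (p.1.2, p.2)).
  apply: measurableT_comp; first exact: measurable_rot.
  apply: measurable_fun_pair => //; exact: measurableT_comp.
apply: measurable_fun_pair; last exact: measurableT_comp.
by apply: measurable_fun_pair; exact: measurableT_comp.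
Qed.

Variable f : R * R * R -> \bar R.
Hypothesis mf : measurable_fun [set: R * R * R] f.
Hypothesis f0 : forall p, (0 <= f p)%E.

Let mf_xz y : measurable_fun [set: R * R] (fun q => f (q.1, y, q.2)).
Proof.
apply: (measurableT_comp mf); apply: measurable_fun_pair => //.
exact: measurable_fun_pair.
Qed.

Let mf_yz x : measurable_fun [set: R * R] (fun q => f (x, q.1, q.2)).
Proof.
apply: (measurableT_comp mf); apply: measurable_fun_pair => //.
exact: measurable_fun_pair.
Qed.

Let mfz : measurable_fun [set: R * R] (fun p => \int[g1]_z f (p, z))%E.
Proof. exact: measurable_fun_fubini_tonelli_F. Qed.

Let fz0 p : (0 <= \int[g1]_z f (p, z))%E.
Proof. exact: integral_ge0. Qed.

Lemma gauss3_xy : (\int[gauss3]_p f p = \int[g2]_p \int[g1]_z f (p, z))%E.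
Proof. exact: (fubini_tonelli1 f mf f0). Qed.

Lemma gauss3_xz :
  (\int[gauss3]_p f p = \int[g1]_y \int[g2]_q f (q.1, y, q.2))%E.
Proof.
rewrite gauss3_xy (gauss2_fubini2 mfz fz0); apply: eq_integral => y _.
by rewrite (gauss2_fubini1 (mf_xz y)).
Qed.

Lemma gauss3_yz :
  (\int[gauss3]_p f p = \int[g1]_x \int[g2]_q f (x, q.1, q.2))%E.
Proof.
rewrite gauss3_xy (gauss2_fubini1 mfz fz0); apply: eq_integral => x _.
by rewrite (gauss2_fubini1 (mf_yz x)).
Qed.

Lemma gauss3E (E : set (R * R * R)) :
  gauss3 E = (\int[g2]_p g1 (xsection E p))%E.
Proof. by []. Qed.

End gauss3.
Opaque gauss3.

Section gauss3_rot.
Context {R : realType}.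
Notation g1 := (@gauss1 R).
Notation g2 := (@gauss2 R).
Variable f : R * R * R -> \bar R.
Hypothesis mf : measurable_fun [set: R * R * R] f.
Hypothesis f0 : forall p, (0 <= f p)%E.
Variables c s : R.
Hypothesis (cs1 : c ^+ 2 + s ^+ 2 = 1) (cN1 : c != -1).

Lemma integral_gauss3_rotxz :
  (\int[gauss3]_p f (rotxz c s p) = \int[gauss3]_p f p)%E.
Proof.
rewrite (@gauss3_xz _ (fun p => f (rotxz c s p)))//; last first.
  by apply: (measurableT_comp mf); exact: measurable_rotxz.
rewrite (gauss3_xz mf f0); apply: eq_integral => y _.
apply: (@integral_gauss2_rot R c s (fun q => f (q.1, y, q.2))) => //.
apply: (measurableT_comp mf); apply: measurable_fun_pair => //.
exact: measurable_fun_pair.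
Qed.

Lemma integral_gauss3_rotyz :
  (\int[gauss3]_p f (rotyz c s p) = \int[gauss3]_p f p)%E.
Proof.
rewrite (@gauss3_yz _ (fun p => f (rotyz c s p)))//; last first.
  by apply: (measurableT_comp mf); exact: measurable_rotyz.
rewrite (gauss3_yz mf f0); apply: eq_integral => x _.
apply: (@integral_gauss2_rot R c s (fun q => f (x, q.1, q.2))) => //.
apply: (measurableT_comp mf); apply: measurable_fun_pair => //.
exact: measurable_fun_pair.
Qed.

End gauss3_rot.

(** * Triangular form of a linear image of independent normal variables *)

Section add_gaussian.
Context {R : realType}.
Notation g2 := (@gauss2 R).

(** The matrix with rows [(a, 0)] and [(b, c)]: it maps [gauss2] to the centered Gaussian law with
    variances [a ^ 2] and [b ^ 2 + c ^ 2] and covariance [a b]. *)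
Definition cholesky (a b c : R) (p : R * R) : R * R :=
  (a * p.1, b * p.1 + c * p.2).

Lemma measurable_cholesky a b c : measurable_fun [set: R * R] (cholesky a b c).
Proof.
apply: measurable_fun_pair; first exact: measurable_funM.
by apply: measurable_funD; exact: measurable_funM.
Qed.

HB.instance Definition _ a b c :=
  isMeasurableFun.Build _ _ _ _ (cholesky a b c) (measurable_cholesky a b c).

Lemma cholesky_gauss3 a b c (E : set (R * R * R)) : measurable E ->
  (distribution g2 (cholesky a b c) \x @gauss1 R)%E E =
  gauss3 [set q | E (cholesky a b c q.1, q.2)].
Proof.
move=> mE; rewrite gauss3E.
pose h := (@gauss1 R \o xsection E : R * R -> \bar R).
have mh : measurable_fun [set: R * R] h by exact: measurable_fun_xsection.
have h0 p : (0 <= h p)%E by exact: measure_ge0.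
transitivity (\int[distribution g2 (cholesky a b c)]_p h p)%E; first by [].
rewrite [LHS](ge0_integral_distribution _ mh h0); apply: eq_integral => p _.
by rewrite /h/=; congr (gauss1 _).
Qed.

(** The condition [0 <= a] makes the cosine nonnegative and so keeps away from the half-turn, to
    which rotation invariance does not apply here. At the origin the angle 0 is chosen. *)
Lemma polar_coordinates (a u : R) : 0 <= a ->
  exists r c s, [/\ 0 <= r, r ^+ 2 = a ^+ 2 + u ^+ 2,
    (c ^+ 2 + s ^+ 2 = 1) /\ c != -1, a = r * c & u = r * s].
Proof.
move=> a0; have au0 : 0 <= a ^+ 2 + u ^+ 2 by rewrite addr_ge0 ?sqr_ge0.
have [r0|r0] := eqVneq (Num.sqrt (a ^+ 2 + u ^+ 2)) 0.
  have /eqP := sqr_sqrtr au0; rewrite r0 expr0n eq_sym paddr_eq0 ?sqr_ge0//.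
  rewrite !sqrf_eq0 => /andP[/eqP -> /eqP ->]; exists 0, 1, 0.
  rewrite !expr0n expr1n !addr0 !mul0r; split => //.
  by split => //; rewrite -subr_eq0; apply/eqP; lra.
have rp : 0 < Num.sqrt (a ^+ 2 + u ^+ 2) by rewrite lt_def r0 sqrtr_ge0.
exists (Num.sqrt (a ^+ 2 + u ^+ 2)), (a / Num.sqrt (a ^+ 2 + u ^+ 2)),
  (u / Num.sqrt (a ^+ 2 + u ^+ 2)); split => //.
- by rewrite sqr_sqrtr.
- split; first by rewrite !expr_div_n -mulrDl sqr_sqrtr// divff// -(sqr_sqrtr au0) sqrf_eq0.
  rewrite gt_eqF//; apply: (@lt_le_trans _ _ 0); first by lra.
  by rewrite divr_ge0// ltW.
- by rewrite mulrC divfK.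
- by rewrite mulrC divfK.
Qed.

(* Two plane rotations bring a linear map of three independent Gaussians onto
   the plane back to lower triangular form. *)
Lemma gauss3_cholesky (a b c u v : R) : 0 <= a -> 0 <= c ->
  exists a' b' c', [/\ (0 <= a') && (0 <= c'), a' ^+ 2 = a ^+ 2 + u ^+ 2,
    a' * b' = a * b + u * v,
    b' ^+ 2 + c' ^+ 2 = b ^+ 2 + c ^+ 2 + v ^+ 2 &
    forall D : set (R * R), measurable D ->
    gauss3 [set p | D ((cholesky a b c p.1).1 + u * p.2,
                       (cholesky a b c p.1).2 + v * p.2)] =
    g2 [set p | D (cholesky a' b' c' p)]].
Proof.
move=> a0 c0; have [a' [C [S [a'0 a'E [CS CN1] aE uE]]]] := polar_coordinates u a0.
(* The map has rows [(a, 0, u)] and [(b, c, v)]. The first rotation sends [(a, u)] to [(a', 0)] and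
   [(b, v)] to [(b', d)]; the second sends [(c, d)] to [(c', 0)] and leaves the first row alone. *)
pose b' := b * C + v * S; pose d := v * C - b * S.
have [c' [C' [S' [c'0 c'E [CS' CN1'] cE dE]]]] := polar_coordinates d c0.
exists a', b', c'; split; rewrite ?a'0//.
- by rewrite aE uE /b'; ring.
- rewrite c'E /b' /d.
  have -> : b ^+ 2 = b ^+ 2 * (C ^+ 2 + S ^+ 2) by rewrite CS mulr1.
  have -> : v ^+ 2 = v ^+ 2 * (C ^+ 2 + S ^+ 2) by rewrite CS mulr1.
  ring.
move=> D mD.
pose f (p : R * R) : \bar R := (\1_D p)%:E.
have mf : measurable_fun [set: R * R] f.
  by apply/measurable_EFinP; exact: measurable_indic.
have f0 p : (0 <= f p)%E by rewrite lee_fin.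
pose F1 (p : R * R * R) := f (a * p.1.1 + u * p.2, b * p.1.1 + c * p.1.2 + v * p.2).
pose F2 (p : R * R * R) := f (a' * p.1.1, b' * p.1.1 + c * p.1.2 + d * p.2).
pose F3 (p : R * R * R) := f (a' * p.1.1, b' * p.1.1 + c' * p.1.2).
pose F4 (p : R * R) := f (a' * p.1, b' * p.1 + c' * p.2).
have m11 : measurable_fun [set: R * R * R] (fun p => p.1.1).
  exact: measurableT_comp.
have m12 : measurable_fun [set: R * R * R] (fun p => p.1.2).
  exact: measurableT_comp.
have m2 : measurable_fun [set: R * R * R] snd by [].
have mT1 : measurable_fun [set: R * R * R] (fun p : R * R * R =>
    (a * p.1.1 + u * p.2, b * p.1.1 + c * p.1.2 + v * p.2)).
  apply: measurable_fun_pair.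
    by apply: measurable_funD; exact: measurable_funM.
  by apply: measurable_funD; [apply: measurable_funD|]; exact: measurable_funM.
have mT2 : measurable_fun [set: R * R * R] (fun p : R * R * R =>
    (a' * p.1.1, b' * p.1.1 + c * p.1.2 + d * p.2)).
  apply: measurable_fun_pair; first exact: measurable_funM.
  by apply: measurable_funD; [apply: measurable_funD|]; exact: measurable_funM.
have mT3 : measurable_fun [set: R * R * R] (fun p : R * R * R =>
    (a' * p.1.1, b' * p.1.1 + c' * p.1.2)).
  apply: measurable_fun_pair; first exact: measurable_funM.
  by apply: measurable_funD; exact: measurable_funM.
have -> : gauss3 [set p | D ((cholesky a b c p.1).1 + u * p.2,
    (cholesky a b c p.1).2 + v * p.2)] = (\int[gauss3]_p F1 p)%E.
  have mE : measurable [set p : R * R * R | D ((cholesky a b c p.1).1 + u * p.2,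
      (cholesky a b c p.1).2 + v * p.2)].
    by rewrite -[X in measurable X]setTI; exact: (mT1 measurableT _ mD).
  by rewrite -[X in gauss3 X]setIT -integral_indic.
have -> : g2 [set p | D (cholesky a' b' c' p)] =
    (\int[g2]_p F4 p)%E.
  have mE : measurable [set p : R * R | D (cholesky a' b' c' p)].
    by rewrite -[X in measurable X]setTI; exact: (measurable_cholesky a' b' c' measurableT mD).
  by rewrite -[X in g2 X]setIT -integral_indic.
transitivity (\int[gauss3]_p F2 p)%E.
  have CS2 : C ^+ 2 + (- S) ^+ 2 = 1 by rewrite sqrrN.
  rewrite -(@integral_gauss3_rotxz _ F2 (measurableT_comp mf mT2) (fun=> f0 _) _ _ CS2 CN1).
  apply: eq_integral => p _; rewrite /F1 /F2 /rotxz /rot/=; congr (f (_, _)).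
    by rewrite aE uE; ring.
  have -> : b * p.1.1 = b * (C ^+ 2 + S ^+ 2) * p.1.1 by rewrite CS mulr1.
  have -> : v * p.2 = v * (C ^+ 2 + S ^+ 2) * p.2 by rewrite CS mulr1.
  by rewrite /b' /d; ring.
transitivity (\int[gauss3]_p F3 p)%E.
  have CS2 : C' ^+ 2 + (- S') ^+ 2 = 1 by rewrite sqrrN.
  rewrite -(@integral_gauss3_rotyz _ F3 (measurableT_comp mf mT3) (fun=> f0 _) _ _ CS2 CN1').
  apply: eq_integral => p _; rewrite /F3 /F2 /rotyz /rot/=; congr (f (_, _)).
  by rewrite cE dE; ring.
(* The third coordinate has disappeared from the integrand and integrates to 1. *)
rewrite (@gauss3_xy _ F3 (measurableT_comp mf mT3) (fun=> f0 _)).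
apply: eq_integral => p _; rewrite /F3/= integral_cst//.
by rewrite [X in (_ * X)%E](@probability_setT _ _ _ (@gauss1 R)) mule1.
Qed.
End add_gaussian.

(** * From independence to the law of a pair of linear forms *)

Section joint_law.
Context d d1 d2 (T : measurableType d) (T1 : measurableType d1)
  (T2 : measurableType d2) (R : realType).
Variables (P : probability T R) (X : T -> T1) (Y : T -> T2).
Variables (m1 : probability T1 R) (m2 : probability T2 R).

(** Restrict [P] to [C], divide by [k] and push forward by [(X, Y)]: the result agrees with
    [m1 \x m2] on rectangles, hence everywhere. The event [C] is there to carry conditions on the
    remaining variables through an induction. *)
Lemma joint_law (C : set T) (k : R) :
  measurable_fun [set: T] X -> measurable_fun [set: T] Y ->
  measurable C -> 0 <= k ->
  (forall A B, measurable A -> measurable B ->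
    P (X @^-1` A `&` Y @^-1` B `&` C) = (m1 A * m2 B * k%:E)%E) ->
  forall E, measurable E ->
    P ([set w | E (X w, Y w)] `&` C) = ((m1 \x m2) E * k%:E)%E.
Proof.
move=> mX mY mC k0 H E mE.
have mXY : measurable_fun [set: T] (fun w => (X w, Y w)).
  exact: measurable_fun_pair.
have mXYE : measurable [set w | E (X w, Y w)].
  by rewrite -[X in measurable X]setTI; exact: mXY.
(* Dividing by [k = 0] is impossible, but then [C] is null and both sides vanish. *)
move: k0; rewrite le_eqVlt => /predU1P[k0|k0].
  rewrite -k0 mule0; have := H setT setT measurableT measurableT.
  rewrite !preimage_setT !setTI -k0 mule0 => PC0.
  by apply: (subset_measure0 _ _ _ PC0) => //; exact: measurableI.
have k'0 : 0 <= k^-1 by rewrite invr_ge0 ltW.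
pose m := measure_function_pushforward__canonical__measure_function_Measure
  (mscale (NngNum k'0) (mrestr P mC)) mXY.
rewrite (@product_measure_unique _ _ _ _ _ m1 m2 m)//.
  by rewrite /m/= /pushforward /mscale/= /mrestr muleAC -EFinM mulVf ?mul1e// gt_eqF.
move=> A B mA mB; rewrite /m/= /pushforward /mscale/= /mrestr.
have -> : (fun w => (X w, Y w)) @^-1` (A `*` B) = X @^-1` A `&` Y @^-1` B by [].
by rewrite H// muleC -muleA -EFinM divff ?mule1// gt_eqF.
Qed.
End joint_law.

Section pair_law.
Context d (T : measurableType d) (R : realType).
Variables (P : probability T R) (n : nat) (xi : 'I_n -> {RV P >-> R}).
Hypothesis xi_indep : mutually_independent xi.
Hypothesis xi_law : forall i (A : set R), measurable A ->
  distribution P (xi i) A = normal_prob 0 1 A.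
Variables u v : 'I_n -> R.

Let box (B : 'I_n -> set R) := \bigcap_(i in [set: 'I_n]) (xi i @^-1` B i).

Let measurable_xi i (A : set R) : measurable A -> measurable (xi i @^-1` A).
Proof. by move=> mA; rewrite -[X in measurable X]setTI; exact: measurable_funPT. Qed.

Let measurable_box B : (forall i, measurable (B i)) -> measurable (box B).
Proof.
by move=> mB; apply: fin_bigcap_measurable => // i _; exact: measurable_xi.
Qed.

Let P_box B : (forall i, measurable (B i)) ->
  P (box B) = (\prod_(i < n) gauss1 (B i))%E.
Proof.
move=> mB; rewrite /box xi_indep//; apply: eq_bigr => i _.
by rewrite gauss1E -(xi_law i (mB i)).
Qed.

Let partial (c : 'I_n -> R) (k : nat) (w : T) : R :=
  \sum_(i < n | (i < k)%N) c i * xi i w.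

Let measurable_partial c k : measurable_fun [set: T] (partial c k).
Proof.
have -> : partial c k =
    (fun w => \sum_(i < n) if (i < k)%N then c i * xi i w else 0).
  by apply/funext => w; rewrite /partial big_mkcond.
apply: measurable_sum => i; case: (i < k)%N => //.
exact: measurable_funM.
Qed.

Let sum_ltS (F : 'I_n -> R) (k : nat) (hk : (k < n)%N) :
  \sum_(i < n | (i < k.+1)%N) F i =
  \sum_(i < n | (i < k)%N) F i + F (Ordinal hk).
Proof.
rewrite (bigD1 (Ordinal hk))//= addrC; congr (_ + _); apply: eq_bigl => i.
by rewrite ltnS ltn_neqAle andbC.
Qed.

(** Since the independence hypothesis speaks of boxes, the statement keeps a box [B] that is free on
    the variables not yet summed. It says at once that the partial sums have a triangular Gaussian
    law and that they are independent of those variables; the second fact is what allows the next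
    one to be added. *)
Let pair_law_partial (k : nat) : (k <= n)%N ->
  exists a b c, [/\ (0 <= a) && (0 <= c),
    a ^+ 2 = \sum_(i < n | (i < k)%N) u i ^+ 2,
    a * b = \sum_(i < n | (i < k)%N) u i * v i,
    b ^+ 2 + c ^+ 2 = \sum_(i < n | (i < k)%N) v i ^+ 2 &
    forall (D : set (R * R)) (B : 'I_n -> set R),
    measurable D -> (forall i, measurable (B i)) ->
    (forall i : 'I_n, (i < k)%N -> B i = setT) ->
    P ([set w | D (partial u k w, partial v k w)] `&` box B) =
    (gauss2 [set p | D (cholesky a b c p)] * \prod_(i < n) gauss1 (B i))%E].
Proof.
elim: k => [_|k IH kn].
  exists 0, 0, 0; split; rewrite ?lexx ?big_pred0 ?expr0n ?mul0r ?addr0//.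
  move=> D B mD mB _; rewrite -(P_box mB).
  have -> : [set p | D (cholesky 0 0 0 p)] = [set _ | D (0, 0)].
    by apply/funext => p /=; rewrite /cholesky !mul0r addr0.
  have -> : [set w | D (partial u 0 w, partial v 0 w)] = [set _ | D (0, 0)].
    by apply/funext => p /=; rewrite /partial !big_pred0.
  have [D0|D0] := pselect (D (0, 0)).
    rewrite (_ : [set _ | D (0, 0)] = setT); last by apply/seteqP; split.
    rewrite (_ : [set _ | D (0, 0)] = setT); last by apply/seteqP; split.
    by rewrite setTI (@probability_setT _ _ _ (@gauss2 R)) mul1e.
  rewrite (_ : [set _ | D (0, 0)] = set0); last by apply/seteqP; split.
  rewrite (_ : [set _ | D (0, 0)] = set0); last by apply/seteqP; split.
  by rewrite set0I !measure0 mul0e.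
have [a [b [c [/andP[a0 c0] aE abE bcE H]]]] := IH (ltnW kn).
pose j := Ordinal kn.
have [a' [b' [c' [/andP[a'0 c'0] a'E ab'E bc'E H']]]] :=
  gauss3_cholesky b (u j) (v j) a0 c0.
exists a', b', c'; split; rewrite ?a'0//.
- by rewrite a'E aE (sum_ltS _ kn).
- by rewrite ab'E abE (sum_ltS _ kn).
- by rewrite bc'E bcE (sum_ltS _ kn).
move=> D B mD mB BT.
pose E : set (R * R * R) := [set q | D (q.1.1 + u j * q.2, q.1.2 + v j * q.2)].
have mE : measurable E.
  rewrite -[X in measurable X]setTI.
  have mf : measurable_fun [set: R * R * R]
      (fun q => (q.1.1 + u j * q.2, q.1.2 + v j * q.2)).
    have m11 : measurable_fun [set: R * R * R] (fun q => q.1.1).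
      exact: measurableT_comp.
    have m12 : measurable_fun [set: R * R * R] (fun q => q.1.2).
      exact: measurableT_comp.
    have m2 : measurable_fun [set: R * R * R] snd by [].
    by apply: measurable_fun_pair; apply: measurable_funD => //;
      exact: measurable_funM.
  exact: mf.
pose k' : R := fine (\prod_(i < n) gauss1 (B i))%E.
have k'E : (\prod_(i < n) gauss1 (B i) = k'%:E)%E.
  rewrite fineK//; elim/big_ind : _ => // [x y|i _]; first exact: fin_numM.
  exact: fin_num_measure.
have k'0 : 0 <= k' by rewrite fine_ge0// prode_ge0.
rewrite k'E -(H' D mD).
have mC := measurable_box mB.
transitivity ((distribution gauss2 (cholesky a b c) \x gauss1) E * k'%:E)%E; last first.
  by rewrite (cholesky_gauss3 a b c mE).
rewrite -(@joint_law _ _ _ T _ _ R P (fun w => (partial u k w, partial v k w)) (xi j)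
  (distribution gauss2 (cholesky a b c)) gauss1 (box B) k' _ _ mC k'0 _ E mE)//.
- congr (P (_ `&` _)); apply/funext => w; rewrite /E/=.
  by rewrite /partial !(sum_ltS _ kn).
- by apply: measurable_fun_pair; exact: measurable_partial.
move=> A B' mA mB'.
(* The slot [j] of [B] is [setT], so the condition on [xi j] can be stored there and the induction
   hypothesis applied to the new box. *)
pose B2 i := if i == j then B' else B i.
have BjT : B j = setT by apply: BT.
have mB2 i : measurable (B2 i) by rewrite /B2; case: ifP.
have -> : (fun w => (partial u k w, partial v k w)) @^-1` A `&` xi j @^-1` B' `&` box B
    = [set w | A (partial u k w, partial v k w)] `&` box B2.
  rewrite -setIA; congr (_ `&` _); apply/seteqP; split => w.
    move=> [wB' wB] i _; rewrite /B2; case: eqP => [->//|_]; exact: wB.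
  move=> wB2; split; first by have := wB2 j I; rewrite /B2 eqxx.
  move=> i _; have [->|ij] := eqVneq i j; first by rewrite BjT.
  by have := wB2 i I; rewrite /B2 (negbTE ij).
rewrite H//; last first.
  move=> i ik; rewrite /B2; case: eqP => [ij|_].
    by rewrite ij /= ltnn in ik.
  by apply: BT; exact: ltnW.
rewrite -muleA; congr (_ * _)%E.
rewrite -k'E (bigD1 j)//= [in RHS](bigD1 j)//= BjT.
rewrite (@probability_setT _ _ _ (@gauss1 R)) mul1e {1}/B2 eqxx; congr (_ * _)%E.
by apply: eq_bigr => i ij; rewrite /B2 (negbTE ij).
Qed.

Lemma gaussian_pair_law :
  exists a b c, [/\ (0 <= a) && (0 <= c),
    a ^+ 2 = \sum_(i < n) u i ^+ 2, a * b = \sum_(i < n) u i * v i,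
    b ^+ 2 + c ^+ 2 = \sum_(i < n) v i ^+ 2 &
    forall D : set (R * R), measurable D ->
    P [set w | D (\sum_(i < n) u i * xi i w, \sum_(i < n) v i * xi i w)] =
    gauss2 [set p | D (cholesky a b c p)]].
Proof.
have [a [b [c [ac aE abE bcE H]]]] := pair_law_partial (leqnn n).
have eqn (F : 'I_n -> R) : \sum_(i < n | (i < n)%N) F i = \sum_(i < n) F i.
  by apply: eq_bigl => i; rewrite ltn_ord.
exists a, b, c; split; rewrite // -?eqn// => D mD.
have := H D (fun=> setT) mD (fun=> measurableT) (fun _ _ => erefl).
rewrite big1 ?mule1 => [<-|i _]; last exact: (@probability_setT _ _ _ (@gauss1 R)).
congr (P _); apply/seteqP; split => w; rewrite /partial /= !eqn.
  by move=> h; split.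
by case.
Qed.
End pair_law.

(** * Small balls and sign changes of Gaussian linear forms *)

Section pair_consequences.
Context d (T : measurableType d) (R : realType).
Variables (P : probability T R) (n : nat) (xi : 'I_n -> {RV P >-> R}).
Hypothesis xi_indep : mutually_independent xi.
Hypothesis xi_law : forall i (A : set R), measurable A ->
  distribution P (xi i) A = normal_prob 0 1 A.

(** The pair law with [v = u] is read on its first coordinate, [sqrt K] times a standard normal
    variable; as the density is at most 1, the probability is at most the length of the interval. *)
Lemma gaussian_small_ball (u : 'I_n -> R) (K del : R) :
  \sum_(i < n) u i ^+ 2 = K -> 0 < K -> 0 <= del ->
  (P [set w | `|\sum_(i < n) u i * xi i w| <= del]%R
    <= (2 * (del / Num.sqrt K))%:E)%E.
Proof.
move=> uK K0 del0.
have [a [b [c [/andP[a0 _] aE _ _ H]]]] := gaussian_pair_law xi_indep xi_law u u.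
have mD : measurable [set p : R * R | `|p.1| <= del].
  rewrite -[X in measurable X]setTI; apply: measurable_fun_ler => //.
  exact: measurableT_comp.
rewrite (H _ mD).
have ap : 0 < a.
  rewrite lt_def a0 andbT; apply: contraTneq K0 => a00.
  by rewrite -uK -aE a00 expr0n ltxx.
have -> : Num.sqrt K = a by rewrite -uK -aE sqrtr_sqr ger0_norm.
have -> : [set p | [set p : R * R | `|p.1| <= del] (cholesky a b c p)] =
    `[- (del / a), del / a]%classic `*` [set: R].
  have xE (x : R) : (`|a * x| <= del) = (- (del / a) <= x <= del / a).
    by rewrite normrM (gtr0_norm ap) mulrC -ler_pdivlMr// ler_norml.
  apply/seteqP; split => p; rewrite /cholesky/= in_itv/= xE//.
  by case.
rewrite gauss2X// (@probability_setT _ _ _ (@gauss1 R)) mule1.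
apply: le_trans (gauss1_le_lebesgue _) _ => //.
have da : 0 <= del / a by rewrite divr_ge0.
rewrite lebesgue_measure_itv/=; case: ifP => _; last by rewrite lee_fin mulr_ge0.
by rewrite -EFinB lee_fin; lra.
Qed.

Lemma gaussian_null (u : 'I_n -> R) (K : R) :
  \sum_(i < n) u i ^+ 2 = K -> 0 < K ->
  P [set w | \sum_(i < n) u i * xi i w = 0]%R = 0%E.
Proof.
move=> uK K0; apply/eqP; rewrite eq_le measure_ge0 andbT.
have := gaussian_small_ball uK K0 (lexx 0); rewrite mul0r mulr0.
suff -> : [set w | `|\sum_(i < n) u i * xi i w| <= 0]%R =
   [set w | \sum_(i < n) u i * xi i w = 0]%R by [].
by apply/funext => w /=; apply/propext; rewrite normr_le0; split => /eqP.
Qed.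

(** Equal variances and correlation [cos al] force the triangular rows [a (1, 0)] and
    [a (cos al, sin al)], the sign of [c] selecting the root. Up to the factor [a ^ 2], the product
    is that of [ell 0] and [ell al]. *)
Lemma gaussian_sign_change (u v : 'I_n -> R) (K al : R) :
  \sum_(i < n) u i ^+ 2 = K -> \sum_(i < n) v i ^+ 2 = K -> 0 < K ->
  \sum_(i < n) u i * v i = K * cos al -> 0 < al < pi ->
  P [set w | (\sum_(i < n) u i * xi i w) * (\sum_(i < n) v i * xi i w) < 0]%R =
  (al / pi)%:E.
Proof.
move=> uK vK K0 uvK al0pi.
have [a [b [c [/andP[a0 c0] aE abE bcE H]]]] :=
  gaussian_pair_law xi_indep xi_law u v.
have mD : measurable [set p : R * R | p.1 * p.2 < 0].
  rewrite -[X in measurable X]setTI; apply: measurable_fun_ltr => //.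
  exact: measurable_funM.
rewrite (H _ mD) -(gauss2_differ al0pi).
have ap : 0 < a.
  rewrite lt_def a0 andbT; apply: contraTneq K0 => a00.
  by rewrite -uK -aE a00 expr0n ltxx.
have bE : b = a * cos al.
  by apply: (mulfI (lt0r_neq0 ap)); rewrite abE uvK -uK -aE mulrA -expr2.
have sal : 0 < sin al by exact: sin_gt0_pi.
have cE : c = a * sin al.
  have : c ^+ 2 = (a * sin al) ^+ 2.
    rewrite exprMn sin2cos2 mulrBr mulr1 -exprMn -bE aE uK -vK -bcE; ring.
  move/eqP; rewrite eqf_sqr => /orP[/eqP//|/eqP E].
  have : 0 < a * sin al by rewrite mulr_gt0.
  by rewrite -oppr_lt0 -E ltNge c0.
congr (gauss2 _); apply/funext => p; apply/propext.
rewrite /differ /cholesky /ell/= cos0 sin0 mul1r mul0r addr0 bE cE.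
have -> : a * p.1 * (a * cos al * p.1 + a * sin al * p.2) =
  a ^+ 2 * (p.1 * (cos al * p.1 + sin al * p.2)) by ring.
by rewrite pmulr_rlt0// exprn_gt0.
Qed.

End pair_consequences.

(** * The space of trigonometric polynomials *)

Section trig_integrals.
Context {R : realType}.
Notation mu := (@lebesgue_measure R).

Lemma sin_cos_intpi (x : R) (k : int) :
  sin (x + k%:~R * (pi *+ 2)) = sin x /\ cos (x + k%:~R * (pi *+ 2)) = cos x.
Proof.
have natE n (y : R) : sin (y + n%:R * (pi *+ 2)) = sin y /\ cos (y + n%:R * (pi *+ 2)) = cos y.
  rewrite mulr_natl; elim: n y => [|n IH] y; first by rewrite mulr0n addr0.
  rewrite mulrS addrA; have [-> ->] := IH (y + pi *+ 2).
  by split; [exact: sinD2pi|exact: cosD2pi].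
case: k => n; first by rewrite -pmulrn; exact: natE.
rewrite NegzE mulrNz mulNr -pmulrn.
by have := natE n.+1 (x - n.+1%:R * (pi *+ 2)); rewrite subrK => -[-> ->].
Qed.

Global Instance is_derive_sin_affine (k a x : R) :
  is_derive x 1 (fun t => sin (k * t + a)) (k * cos (k * x + a)).
Proof.
have h : is_derive x 1 (fun t : R => k * t + a) k.
  by apply: is_derive_eq; rewrite scaler1 addr0.
have := @is_derive1_comp R sin (fun t : R => k * t + a) x _ _ (is_derive_sin _) h.
by rewrite mulrC.
Qed.

Global Instance is_derive_cos_affine (k a x : R) :
  is_derive x 1 (fun t => cos (k * t + a)) (- (k * sin (k * x + a))).
Proof.
have h : is_derive x 1 (fun t : R => k * t + a) k.
  by apply: is_derive_eq; rewrite scaler1 addr0.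
have := @is_derive1_comp R cos (fun t : R => k * t + a) x _ _ (is_derive_cos _) h.
by rewrite mulrC mulrN.
Qed.

Lemma continuous_cos_affine (k a : R) : continuous (fun t => cos (k * t + a)).
Proof.
move=> x; apply/differentiable_continuous/derivable1_diffP.
exact: ex_derive.
Qed.

(** The phase [a] treats cosines and sines together: a sine is a cosine with phase [- pi / 2]. *)
Lemma Rintegral_cos (k : int) (a : R) :
  \int[mu]_(t in `[0, 2 * pi]) cos (k%:~R * t + a) =
  if k == 0 then 2 * pi * cos a else 0.
Proof.
have pi0 : 0 < 2 * pi :> R by rewrite mulr_gt0// pi_gt0.
case: eqP => [->|/eqP k0].
  under eq_Rintegral do rewrite mul0r add0r.
  rewrite Rintegral_cst// mulrC; congr (_ * _).
  have := @lebesgue_measure_itv R `[0, 2 * pi].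
  by rewrite /= lte_fin pi0 -EFinB subr0 => ->.
have kR0 : k%:~R != 0 :> R by rewrite intr_eq0.
pose F (t : R) : R := k%:~R^-1 * sin (k%:~R * t + a).
have dF (x : R) : is_derive x 1 F (cos (k%:~R * x + a)).
  have := is_deriveZ k%:~R^-1 (is_derive_sin_affine k%:~R a x).
  by rewrite /GRing.scale/= mulrA mulVf// mul1r.
have cF (x : R) : {for x, continuous F}.
  apply/differentiable_continuous/derivable1_diffP.
  exact: ex_derive.
rewrite /Rintegral (@continuous_FTC2 _ _ F)//.
- rewrite /F !mulr0 add0r (_ : k%:~R * (2 * pi) + a = a + k%:~R * (pi *+ 2)).
    by rewrite (sin_cos_intpi _ _).1 -EFinB subrr.
  by rewrite mulr_natl addrC.
- by apply: continuous_subspaceT; exact: continuous_cos_affine.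
- split.
  + by move=> x _; exact: ex_derive.
  + by apply: cvg_at_right_filter; exact: cF.
  + by apply: cvg_at_left_filter; exact: cF.
- by move=> x _; rewrite derive1E; exact: derive_val.
Qed.

End trig_integrals.

Section trig_inner.
Context {R : realType}.
Notation mu := (@lebesgue_measure R).
Implicit Types f g : R -> R.

Let integrable_prod f g : continuous f -> continuous g ->
  mu.-integrable `[0, 2 * pi]%classic (EFin \o (f \* g)).
Proof.
move=> cf cg; apply: continuous_compact_integrable; first exact: segment_compact.
by apply: continuous_subspaceT => x; apply: continuousM; [exact: cf|exact: cg].
Qed.

Lemma innerC f g : inner f g = inner g f.
Proof. by rewrite /inner; apply: eq_Rintegral => x _; rewrite mulrC. Qed.

Lemma innerZl c f g : continuous f -> continuous g ->
  inner (fun t => c * f t) g = c * inner f g.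
Proof.
move=> cf cg; rewrite /inner -RintegralZl//; last exact: integrable_prod.
by apply: eq_Rintegral => x _; rewrite mulrA.
Qed.

Lemma innerDl f1 f2 g : continuous f1 -> continuous f2 -> continuous g ->
  inner (fun t => f1 t + f2 t) g = inner f1 g + inner f2 g.
Proof.
move=> cf1 cf2 cg.
rewrite /inner -RintegralD//; [|exact: integrable_prod|exact: integrable_prod].
by apply: eq_Rintegral => x _; rewrite mulrDl.
Qed.

Lemma continuous_sumf n (F : 'I_n -> R -> R) :
  (forall i, continuous (F i)) -> continuous (fun t => \sum_(i < n) F i t).
Proof.
move=> cF; elim: n F cF => [|n IH] F cF.
  by under eq_fun do rewrite big_ord0; exact: cst_continuous.
under eq_fun do rewrite big_ord_recl.
by move=> x; apply: continuousD; [exact: cF|exact: IH].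
Qed.

Lemma inner_suml n (F : 'I_n -> R -> R) g :
  (forall i, continuous (F i)) -> continuous g ->
  inner (fun t => \sum_(i < n) F i t) g = \sum_(i < n) inner (F i) g.
Proof.
move=> cF cg; elim: n F cF => [|n IH] F cF.
  rewrite big_ord0 /inner; under eq_Rintegral do rewrite big_ord0 mul0r.
  by rewrite Rintegral_cst// mul0r.
rewrite big_ord_recl -IH// -innerDl//.
  by congr (inner _ _); apply/funext => t; rewrite big_ord_recl.
exact: continuous_sumf.
Qed.

Lemma inner_cos (k l : int) (a b : R) :
  inner (fun t => cos (k%:~R * t + a)) (fun t => cos (l%:~R * t + b)) =
  pi * ((k == - l)%:R * cos (a + b) + (k == l)%:R * cos (a - b)).
Proof.
pose c1 t : R := cos ((k + l)%:~R * t + (a + b)).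
pose c2 t : R := cos ((k - l)%:~R * t + (a - b)).
have int c : continuous c -> mu.-integrable `[0, 2 * pi]%classic (EFin \o c).
  move=> cc; apply: continuous_compact_integrable; first exact: segment_compact.
  exact: continuous_subspaceT.
have i1 : mu.-integrable `[0, 2 * pi]%classic (EFin \o c1).
  by apply: int; exact: continuous_cos_affine.
have i2 : mu.-integrable `[0, 2 * pi]%classic (EFin \o c2).
  by apply: int; exact: continuous_cos_affine.
transitivity (2^-1 * \int[mu]_(t in `[0, 2 * pi]) (c1 t + c2 t)).
  rewrite -RintegralZl//; last first.
    by apply: int => x; apply: continuousD; exact: continuous_cos_affine.
  apply: eq_Rintegral => t _; rewrite /c1 /c2.
  have -> : (k + l)%:~R * t + (a + b) = (k%:~R * t + a) + (l%:~R * t + b) :> R.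
    by rewrite intrD; ring.
  have -> : (k - l)%:~R * t + (a - b) = (k%:~R * t + a) - (l%:~R * t + b) :> R.
    by rewrite intrB; ring.
  move: (k%:~R * t + a) (l%:~R * t + b) => A B.
  by rewrite cosD cosB; field.
rewrite RintegralD// !Rintegral_cos subr_eq0 addr_eq0.
by case: eqP => _; case: eqP => _; rewrite ?mul1r ?mul0r ?addr0 ?add0r; field.
Qed.

Definition trig m (al be : 'I_(m.*2.+1) -> R) (t : R) : R :=
  \sum_(j < m.*2.+1) (al j * cos ((freq j)%:~R * t)
                     + be j * sin ((freq j)%:~R * t)).

Lemma freq_rev m (j : 'I_(m.*2.+1)) : freq (rev_ord j) = - freq j.
Proof.
rewrite /freq/=; move: (nat_of_ord j) (ltn_ord j) => k; rewrite ltnS => km.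
by rewrite subSS -subzn// -addnn PoszD; ring.
Qed.

Lemma freq_inj m : injective (@freq m).
Proof. by move=> i j /addIr[] ij; exact: val_inj. Qed.

Let cos_affine0 (k : int) : (fun t : R => cos (k%:~R * t)) = (fun t => cos (k%:~R * t + 0)).
Proof. by apply/funext => t; rewrite addr0. Qed.

Let sin_affine (k : int) : (fun t : R => sin (k%:~R * t)) =
  (fun t => cos (k%:~R * t + - (pi / 2))).
Proof. by apply/funext => t; rewrite cosBpihalf. Qed.

Let continuous_cosk (k : int) : continuous (fun t : R => cos (k%:~R * t)).
Proof. by rewrite cos_affine0; exact: continuous_cos_affine. Qed.

Let continuous_sink (k : int) : continuous (fun t : R => sin (k%:~R * t)).
Proof. by rewrite sin_affine; exact: continuous_cos_affine. Qed.

Let continuous_term (k : int) (a b : R) :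
  continuous (fun t : R => a * cos (k%:~R * t) + b * sin (k%:~R * t)).
Proof.
move=> x; apply: cvgD; apply: cvgMr; [exact: continuous_cosk|exact: continuous_sink].
Qed.

Lemma continuous_trig m (al be : 'I_(m.*2.+1) -> R) : continuous (trig al be).
Proof.
by apply: continuous_sumf => j; exact: continuous_term.
Qed.

(** The coefficients of [trig] are not unique: a frequency occurs at [i] and, with opposite sign, at
    [rev_ord i]. Only the sum of the cosine coefficients and the difference of the sine ones can be
    recovered. *)
Lemma inner_trig_cos m (al be : 'I_(m.*2.+1) -> R) (i : 'I_(m.*2.+1)) (b : R) :
  inner (trig al be) (fun t => cos ((freq i)%:~R * t + b)) =
  pi * ((al i + al (rev_ord i)) * cos b + (be (rev_ord i) - be i) * sin b).
Proof.
have cb : continuous (fun t : R => cos ((freq i)%:~R * t + b)).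
  exact: continuous_cos_affine.
rewrite inner_suml//.
have termE j : inner (fun t => al j * cos ((freq j)%:~R * t) + be j * sin ((freq j)%:~R * t))
    (fun t => cos ((freq i)%:~R * t + b)) =
    pi * ((j == rev_ord i)%:R * (al j * cos b + be j * sin b) +
          (j == i)%:R * (al j * cos b - be j * sin b)).
  rewrite innerDl//; last 2 first.
  - by move=> x; apply: continuousM; [exact: cst_continuous|exact: continuous_cosk].
  - by move=> x; apply: continuousM; [exact: cst_continuous|exact: continuous_sink].
  rewrite !innerZl// cos_affine0 sin_affine !inner_cos add0r sub0r cosN.
  rewrite -freq_rev !(inj_eq (@freq_inj m)).
  rewrite [- _ + b]addrC cosBpihalf -opprD cosN [_ + b]addrC cosDpihalf.
  ring.
under eq_bigr do rewrite termE.
rewrite -mulr_sumr big_split/= (bigD1 (rev_ord i))//= eqxx big1 ?addr0; last first.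
  by move=> j /negbTE ->; rewrite mul0r.
rewrite [X in _ + X](bigD1 i)//= eqxx big1 ?addr0; last first.
  by move=> j /negbTE ->; rewrite mul0r.
have -> : true%:R = 1 :> R by [].
ring.
Qed.

Definition dirichlet m (t s : R) : R :=
  (2 * pi)^-1 * \sum_(j < m.*2.+1) cos ((freq j)%:~R * (t - s)).

Lemma dirichlet_trig m (s : R) : (dirichlet m)^~ s =
  trig (fun j : 'I_(m.*2.+1) => (2 * pi)^-1 * cos ((freq j)%:~R * s))
       (fun j => (2 * pi)^-1 * sin ((freq j)%:~R * s)).
Proof.
apply/funext => t; rewrite /dirichlet /trig mulr_sumr; apply: eq_bigr => j _.
by rewrite mulrBr cosB; ring.
Qed.

(** Reindexing by [rev_ord] shows that the mirrored frequencies contribute as much as the direct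
    ones. The resulting [2 pi] is what the factor in [dirichlet] compensates. *)
Lemma inner_dirichlet m (al be : 'I_(m.*2.+1) -> R) (s : R) :
  inner (trig al be) ((dirichlet m)^~ s) = trig al be s.
Proof.
pose c (j : 'I_(m.*2.+1)) (t : R) : R := cos ((freq j)%:~R * t + - ((freq j)%:~R * s)).
have cc j : continuous (c j) by exact: continuous_cos_affine.
have ct := @continuous_trig m al be.
have csum : continuous (fun t => \sum_(j < m.*2.+1) c j t).
  exact: continuous_sumf.
rewrite innerC (_ : (dirichlet m)^~ s =
    fun t => (2 * pi)^-1 * \sum_(j < m.*2.+1) c j t); last first.
  apply/funext => t; congr (_ * _); apply: eq_bigr => j _.
  by rewrite /c mulrBr.
pose C (j : 'I_(m.*2.+1)) : R := cos ((freq j)%:~R * s).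
pose S (j : 'I_(m.*2.+1)) : R := sin ((freq j)%:~R * s).
rewrite innerZl// inner_suml//.
have termE j : inner (c j) (trig al be) = pi * ((al j * C j + be j * S j) +
    (al (rev_ord j) * C j - be (rev_ord j) * S j)).
  by rewrite innerC inner_trig_cos cosN sinN; congr (_ * _); rewrite /C /S; ring.
under eq_bigr do rewrite termE.
rewrite -mulr_sumr !big_split/= sumrN.
have rev_cos : \sum_(j < m.*2.+1) al (rev_ord j) * C j =
    \sum_(j < m.*2.+1) al j * C j.
  rewrite (reindex_inj rev_ord_inj)/=; apply: eq_bigr => j _.
  by rewrite rev_ordK /C freq_rev mulrNz mulNr cosN.
have rev_sin : \sum_(j < m.*2.+1) be (rev_ord j) * S j =
    - \sum_(j < m.*2.+1) be j * S j.
  rewrite -sumrN (reindex_inj rev_ord_inj)/=; apply: eq_bigr => j _.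
  by rewrite rev_ordK /S freq_rev mulrNz mulNr sinN mulrN.
rewrite rev_cos rev_sin opprK /trig big_split/=.
have := lt0r_neq0 (@pi_gt0 R); rewrite -/C -/S; move: (pi : R) => p p0.
by field.
Qed.

(** By the reproducing property, the coordinates of the kernel at [s] in the basis are the [e i s].
    Hence the covariance of the random polynomial is the same for all orthonormal bases. *)
Lemma orthonormal_kernel m n (e : 'I_n -> R -> R) :
  orthonormal_basis (@Trig R m) e ->
  forall t s, \sum_(i < n) e i t * e i s = dirichlet m t s.
Proof.
move=> [eT eO eS] t s.
have [c cE] : exists c : 'I_n -> R, (dirichlet m)^~ s = fun t => \sum_(i < n) c i * e i t.
  by apply: eS; rewrite dirichlet_trig; do 2 eexists.
have ce i : continuous (e i).
  by have [al [be ->]] := eT i; exact: continuous_trig.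
have ciE i : c i = e i s.
  have [al [be eE]] := eT i.
  have -> : e i s = inner (e i) ((dirichlet m)^~ s) by rewrite eE inner_dirichlet.
  rewrite cE innerC inner_suml//; last first.
    by move=> j x; apply: continuousM; [exact: cst_continuous|exact: ce].
  under eq_bigr do rewrite innerZl// eO.
  rewrite (bigD1 i)//= eqxx mulr1 big1 ?addr0// => j /negbTE ->.
  by rewrite mulr0.
rewrite -[RHS]/((dirichlet m)^~ s t) cE; apply: eq_bigr => i _.
by rewrite ciE mulrC.
Qed.

End trig_inner.

(** * Roots of Laurent polynomials *)

Section laurent_algebra.
Local Open Scope complex_scope.
Context {R : realType}.
Implicit Types (t : R) (k : int).

Definition cis t : R[i] := cos t +i* sin t.

Lemma cisD t s : cis (t + s) = cis t * cis s.
Proof. by rewrite /cis cosD sinD; simpc; congr (_ +i* _); rewrite addrC. Qed.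

Lemma cis0 : cis 0 = 1.
Proof. by rewrite /cis cos0 sin0. Qed.

Lemma cis_norm t : `|cis t| = 1.
Proof. by rewrite normc_def/= cos2Dsin2 sqrtr1. Qed.

Lemma cis_neq0 t : cis t != 0.
Proof. by rewrite -normr_eq0 cis_norm oner_eq0. Qed.

Lemma cis_exprz t k : cis t ^ k = cis (k%:~R * t).
Proof.
have natE n s : cis s ^+ n = cis (n%:R * s).
  elim: n => [|n IH]; first by rewrite expr0 mul0r cis0.
  by rewrite exprS IH -cisD -add1n natrD mulrDl mul1r.
case: k => n; first by rewrite -exprnP natE pmulrn.
rewrite NegzE -exprnN natE mulrNz mulNr -pmulrn; apply: (mulfI (cis_neq0 (n.+1%:R * t))).
by rewrite mulfV ?cis_neq0// -cisD subrr cis0.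
Qed.

Lemma Re_sum n (F : 'I_n -> R[i]) :
  complex.Re (\sum_(j < n) F j) = \sum_(j < n) complex.Re (F j).
Proof.
elim: n F => [|n IH] F; first by rewrite !big_ord0.
by rewrite !big_ord_recl -IH; case: (F ord0) (\sum_(_ < _) _) => ? ? [].
Qed.

Lemma Im_sum n (F : 'I_n -> R[i]) :
  complex.Im (\sum_(j < n) F j) = \sum_(j < n) complex.Im (F j).
Proof.
elim: n F => [|n IH] F; first by rewrite !big_ord0.
by rewrite !big_ord_recl -IH; case: (F ord0) (\sum_(_ < _) _) => ? ? [].
Qed.

Lemma restr_circleE m (a : laurent R m) :
  restr_circle a = trig (fun j => complex.Re (a j)) (fun j => - complex.Im (a j)).
Proof.
apply/funext => t; rewrite /restr_circle /laurent_eval Re_sum; apply: eq_bigr => j _.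
by rewrite -/(cis t) cis_exprz /cis; case: (a j) => x y; simpc.
Qed.

Lemma Im_laurent_evalE m (a : laurent R m) t :
  complex.Im (laurent_eval a (cis t)) =
  trig (fun j => complex.Im (a j)) (fun j => complex.Re (a j)) t.
Proof.
rewrite /laurent_eval Im_sum; apply: eq_bigr => j _.
by rewrite cis_exprz /cis; case: (a j) => x y; simpc => /=; rewrite addrC.
Qed.

Lemma real_laurent_cis m (a : laurent R m) t : real_laurent a ->
  laurent_eval a (cis t) = (restr_circle a t)%:C.
Proof.
move=> /(_ (cis t) (cis_norm t)) /RRe_real <-.
by rewrite /restr_circle -/(cis t).
Qed.

Lemma freq_max m : freq (@ord_max m.*2) = m.
Proof. by rewrite /freq/= -addnn PoszD addrK. Qed.

(* Testing Im P = 0 against sin (m t) and Re P against cos (m t) recovers the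
   two extreme coefficients. *)
Lemma real_laurent_extreme m (a : laurent R m) : real_laurent a ->
  inner (restr_circle a) (fun t => cos (m%:R * t)) != 0 ->
  a ord_max != 0 /\ a ord0 != 0.
Proof.
move=> ra; rewrite restr_circleE.
have rev_max : rev_ord (@ord_max m.*2) = ord0 by apply/val_inj; rewrite /= subnn.
have -> : (fun t : R => cos (m%:R * t)) =
    (fun t => cos ((freq (@ord_max m.*2))%:~R * t + 0)).
  by apply/funext => t; rewrite freq_max addr0.
rewrite inner_trig_cos rev_max cos0 sin0 mulr0 addr0 mulr1 => nz.
have : inner (trig (fun j => complex.Im (a j)) (fun j => complex.Re (a j)))
    (fun t => cos ((freq (@ord_max m.*2))%:~R * t + - (pi / 2))) = 0.
  have -> : trig (fun j => complex.Im (a j)) (fun j => complex.Re (a j)) = cst 0.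
    apply/funext => t; rewrite -Im_laurent_evalE real_laurent_cis//.
  rewrite /inner; under eq_Rintegral do rewrite mul0r.
  by rewrite Rintegral_cst// mul0r.
rewrite inner_trig_cos rev_max cosN sinN cos_pihalf sin_pihalf mulr0 add0r.
move/eqP; rewrite mulf_eq0 (gt_eqF (@pi_gt0 R))/= mulrN1 oppr_eq0 subr_eq0 => /eqP E.
have {}nz : complex.Re (a ord_max) != 0.
  by apply: contraNneq nz => E1; rewrite E E1 addr0 mulr0.
split; first by apply: contraNneq nz => ->.
by apply: contraNneq nz => E2; rewrite -E E2.
Qed.

Section roots.
Variables (m : nat) (a : laurent R m).
Hypotheses (amax : a ord_max != 0) (a0 : a ord0 != 0).

Let p := laurent_poly a.

Let pE : p = \poly_(i < m.*2.+1) a (inord i).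
Proof.
rewrite poly_def; apply: eq_bigr => i _; congr (_ *: _); congr (a _).
by rewrite inord_val.
Qed.

Let size_p : size p = m.*2.+1.
Proof.
rewrite pE size_poly_eq//.
by rewrite (_ : inord m.*2 = ord_max)//; apply/val_inj; rewrite /= inordK.
Qed.

Let p_neq0 : p != 0.
Proof. by rewrite -size_poly_eq0 size_p. Qed.

Let horner_p z : z != 0 -> p.[z] = z ^+ m * laurent_eval a z.
Proof.
move=> z0; rewrite /p /laurent_poly /laurent_eval horner_sum mulr_sumr.
apply: eq_bigr => j _; rewrite hornerZ hornerXn mulrCA; congr (_ * _).
by rewrite /freq expfzDr// -exprnN -exprnP mulrCA mulfV ?mulr1// expf_neq0.
Qed.

Let root0 : ~~ root p 0.
Proof.
rewrite rootE horner_coef0 pE coef_poly/= (_ : inord 0 = ord0)//.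
by apply/val_inj; rewrite /= inordK.
Qed.

Lemma laurent_rootsE : laurent_roots a = [set z | root p z].
Proof.
apply/seteqP; split => z /=.
  by move=> [z0 az]; rewrite rootE horner_p// az mulr0.
move=> rz; have z0 : z != 0 by apply: contraTneq rz => ->.
split => //; apply/eqP; move: rz; rewrite rootE horner_p// mulf_eq0.
by rewrite expf_eq0 (negbTE z0) andbF.
Qed.

Lemma finite_laurent_roots : finite_set (laurent_roots a).
Proof.
have [rs E] := closed_field_poly_normal p.
rewrite laurent_rootsE; apply: (sub_finite_set _ (finite_seq rs)) => z /=.
by rewrite E rootZ ?lead_coef_eq0// root_prod_XsubC.
Qed.

(** Distinct roots are at most as many as the degree; this constant dominates all the sign-change
    counts. *)
Lemma nb_real_roots_le : (@nb_real_roots R m a <= (m.*2%:R)%:E)%E.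
Proof.
have fin := finite_laurent_roots.
have finr : finite_set (real_roots a) by apply: sub_finite_set fin => z [].
rewrite /nb_real_roots /counting asboolT// lee_fin ler_nat -ltnS -size_p.
apply: max_poly_roots => //; last exact: fset_uniq.
apply/allP => z zr; have : z \in fset_set (real_roots a) by [].
by rewrite in_fset_set// => /set_mem[]; rewrite laurent_rootsE.
Qed.

(** The polynomial splits over the complex numbers; [mup z] counts the occurrences of [z] in the
    list of its roots, whose length is the degree. *)
Lemma nb_rootsE : nb_roots a = m.*2.
Proof.
have [rs E] := closed_field_poly_normal p.
have lp0 : lead_coef p != 0 by rewrite lead_coef_eq0.
have rootE z : root p z = (z \in rs) by rewrite E rootZ// root_prod_XsubC.
have mupE z : mup z p = count_mem z rs.
  rewrite E -mul_polyC mupM ?polyC_eq0//; last first.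
    by rewrite monic_neq0// monic_prod_XsubC.
  by rewrite mu_prod_XsubC mupNroot// rootC.
rewrite /nb_roots fsbig_finite; last exact: finite_laurent_roots.
rewrite (perm_big (undup rs)); last first.
  apply: uniq_perm; [exact: fset_uniq|exact: undup_uniq|move=> z].
  transitivity (z \in fset_set (laurent_roots a)); first by [].
  rewrite in_fset_set; last exact: finite_laurent_roots.
  rewrite laurent_rootsE mem_undup -rootE.
  by apply/idP/idP => [/set_mem//|rz]; exact: mem_set.
under eq_bigr do rewrite mupE.
have -> : m.*2 = size rs.
  by have := size_p; rewrite E size_scale// size_prod_XsubC => -[].
rewrite -[RHS](perm_size (perm_count_undup rs)) size_flatten /shape -map_comp.
by rewrite sumnE big_map; apply: eq_bigr => z _; rewrite /= size_nseq.
Qed.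

End roots.
End laurent_algebra.

(** * Zeros and sign changes *)

Section sign_changes.
Context {R : realType}.
Implicit Types (f g : R -> R) (t x z : R).

Definition grid (n j : nat) : R := j%:R * (2 * pi / n%:R).

(** The interval is half-open so that each point of the circle has exactly one argument. *)
Definition period_zeros f : set R := [set t | 0 <= t < 2 * pi /\ f t = 0].

Definition sign_changes f (n : nat) : nat :=
  \sum_(j < n) (f (grid n j) * f (grid n j.+1) < 0)%R.

Let pi2_gt0 : 0 < 2 * pi :> R.
Proof. by rewrite mulr_gt0// pi_gt0. Qed.

Lemma grid_step n j : grid n j.+1 = grid n j + 2 * pi / n%:R.
Proof. by rewrite /grid -addn1 natrD mulrDl mul1r. Qed.

Lemma grid_ge0 n j : 0 <= grid n j.
Proof. by rewrite mulr_ge0// divr_ge0// ltW. Qed.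

Lemma grid_le n i j : (i <= j)%N -> grid n i <= grid n j.
Proof. by move=> ij; rewrite ler_wpM2r ?ler_nat// divr_ge0// ltW. Qed.

Lemma grid_full n : (0 < n)%N -> grid n n = 2 * pi.
Proof. by move=> n0; rewrite /grid mulrC divfK// pnatr_eq0 -lt0n. Qed.

Lemma grid_locate n z : (0 < n)%N -> 0 <= z < 2 * pi ->
  exists j : 'I_n, grid n j <= z < grid n j.+1.
Proof.
move=> n0 /andP[z0 zpi].
have h0 : 0 < 2 * pi / n%:R :> R by rewrite divr_gt0// ltr0n.
have /andP[lo up] := truncn_itv (divr_ge0 z0 (ltW h0)).
have lt_n : (Num.truncn (z / (2 * pi / n%:R)) < n)%N.
  rewrite -(ltr_nat R); apply: le_lt_trans lo _.
  by rewrite ltr_pdivrMr// -/(grid n n) grid_full.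
exists (Ordinal lt_n); apply/andP; split => /=.
  by rewrite /grid -ler_pdivlMr.
by rewrite /grid -ltr_pdivrMr.
Qed.

Section derivative.
Variables (f f1 : R -> R).
Hypothesis df : forall x, is_derive x 1 f (f1 x).

Lemma derive_continuous : continuous f.
Proof.
by move=> x; apply/differentiable_continuous/derivable1_diffP; exact: ex_derive.
Qed.

Lemma mean_value x z :
  exists c, `|c - z| <= `|x - z| /\ f x - f z = f1 c * (x - z).
Proof.
have cf i : {within i, continuous f}.
  by apply: continuous_subspaceT; exact: derive_continuous.
have [xz|zx|->] := ltgtP x z.
- have [c cI E] := MVT xz (fun y _ => df y) (cf _); exists c; split; last by lra.
  by move: cI; rewrite in_itv/= => /andP[zc cx]; rewrite !ltr0_norm; lra.
- have [c cI E] := MVT zx (fun y _ => df y) (cf _); exists c; split => //.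
  by move: cI; rewrite in_itv/= => /andP[zc cx]; rewrite !gtr0_norm; lra.
- by exists z; rewrite !subrr mulr0.
Qed.

Lemma sign_change_zero x y : x < y -> f x * f y < 0 ->
  exists2 z, x < z < y & f z = 0.
Proof.
move=> xy fxy.
have cf : {within `[x, y], continuous f}.
  by apply: continuous_subspaceT; exact: derive_continuous.
have : Num.min (f x) (f y) <= 0 <= Num.max (f x) (f y).
  have [fx0|fx0] := leP (f x) 0; have [fy0|fy0] := leP (f y) 0.
  - by move: fxy; rewrite ltNge mulr_le0.
  - by rewrite ge_min le_max fx0 (ltW fy0) /= ?orbT.
  - by rewrite ge_min le_max fy0 (ltW fx0) /= ?orbT.
  - by move: fxy; rewrite ltNge (mulr_ge0 (ltW fx0) (ltW fy0)).
move=> /(IVT (ltW xy) cf)[z]; rewrite in_itv/= => /andP[xz zy] fz.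
exists z => //; rewrite !lt_def xz zy !andbT; apply/andP; split.
  by apply: contraTneq fxy => E; rewrite -E fz mul0r ltxx.
by apply: contraTneq fxy => E; rewrite E fz mulr0 ltxx.
Qed.

(** Each change of sign produces a zero strictly inside its cell, and the open cells are
    disjoint. *)
Lemma sign_changes_le n : finite_set (period_zeros f) ->
  (sign_changes f n <= #|` fset_set (period_zeros f)|)%N.
Proof.
move=> fin; pose sc (j : 'I_n) := f (grid n j) * f (grid n j.+1) < 0.
have /choice[h hP] (j : 'I_n) : exists z, sc j ->
    grid n j < z < grid n j.+1 /\ f z = 0.
  have [s|/negP s] := boolP (sc j); last by exists 0.
  have [|z zI fz] := sign_change_zero _ s; last by exists z.
  by rewrite grid_step ltrDl divr_gt0// ltr0n (leq_ltn_trans _ (ltn_ord j)).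
have -> : sign_changes f n = size [seq h j | j in sc].
  by rewrite size_image -sum1_card /sign_changes [RHS]big_mkcond.
apply: uniq_leq_size.
  rewrite map_inj_in_uniq ?enum_uniq// => i j; rewrite !mem_enum => si sj hij.
  have [/andP[i1 i2] _] := hP _ si; have [/andP[j1 j2] _] := hP _ sj.
  apply/val_inj; case: (ltngtP i j) => // ij /=.
    by have := grid_le n ij; rewrite leNgt (lt_trans j1)// -hij.
  by have := grid_le n ij; rewrite leNgt (lt_trans i1)// hij.
move=> z /mapP[j]; rewrite mem_enum => sj ->.
have [/andP[i1 i2] fz] := hP _ sj.
have n0 : (0 < n)%N by rewrite (leq_ltn_trans _ (ltn_ord j)).
suff : h j \in fset_set (period_zeros f) by [].
rewrite in_fset_set//; apply: mem_set; split => //; apply/andP; split.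
  by rewrite (le_trans (grid_ge0 n j))// ltW.
by rewrite (lt_le_trans i2)// -(grid_full n0) grid_le.
Qed.

End derivative.

Section second_derivative.
Variables (f f1 f2 : R -> R) (C : R).
Hypothesis df : forall x, is_derive x 1 f (f1 x).
Hypothesis df1 : forall x, is_derive x 1 f1 (f2 x).
Hypothesis f2C : forall x, `|f2 x| <= C.

Let f1_lip x z : `|f1 x - f1 z| <= C * `|x - z|.
Proof.
have [c [_ ->]] := mean_value df1 x z.
by rewrite normrM ler_wpM2r.
Qed.

Let C0 : 0 <= C.
Proof. exact: le_trans (f2C 0). Qed.

Lemma double_zero_bound z x : f z = 0 -> f1 z = 0 -> `|f x| <= C * (x - z) ^+ 2.
Proof.
move=> fz f1z; have [c [cz E]] := mean_value df x z.
rewrite -[f x]subr0 -fz E normrM -[f1 c]subr0 -f1z.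
rewrite -real_normK ?num_real// expr2 mulrA ler_wpM2r//.
by rewrite (le_trans (f1_lip c z))// ler_wpM2l.
Qed.

(** The left end of the cell containing [z] is within one mesh of it, and near a double zero [f] is
    quadratically small. *)
Lemma double_zero_grid z n : (0 < n)%N -> 0 <= z < 2 * pi -> f z = 0 -> f1 z = 0 ->
  exists j : 'I_n, `|f (grid n j)| <= C * (2 * pi / n%:R) ^+ 2.
Proof.
move=> n0 zI fz f1z; have [j /andP[jz zj]] := grid_locate n0 zI; exists j.
apply: le_trans (double_zero_bound _ fz f1z) _; rewrite ler_wpM2l//.
rewrite -real_normK ?num_real// ler_sqr ?nnegrE ?divr_ge0 ?(ltW pi2_gt0)//.
by rewrite distrC ger0_norm ?subr_ge0// lerBlDl -grid_step ltW.
Qed.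

(** [f1] is [C]-Lipschitz, so within this radius it keeps the sign that it has at [z], and the mean
    value theorem passes this to [f x]. Dividing by [C + 1] covers the case [C = 0]. *)
Lemma simple_zero_sign z x : f z = 0 -> f1 z != 0 ->
  0 < `|x - z| < `|f1 z| / (C + 1) -> 0 < f x * ((x - z) * f1 z).
Proof.
move=> fz f1z /andP[xz0 xz]; have [c [cz E]] := mean_value df x z.
have -> : f x = f1 c * (x - z) by rewrite -E fz subr0.
have -> : f1 c * (x - z) * ((x - z) * f1 z) = (x - z) ^+ 2 * (f1 c * f1 z) by ring.
rewrite mulr_gt0//; first by rewrite exprn_even_gt0//= -normr_gt0.
have C1 : 0 < C + 1 by rewrite ltr_wpDl.
have lt1 : `|f1 c - f1 z| < `|f1 z|.
  apply: le_lt_trans (f1_lip c z) _.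
  have h : `|x - z| * (C + 1) < `|f1 z| by rewrite -ltr_pdivlMr.
  have h2 : C * `|c - z| <= C * `|x - z| by rewrite ler_wpM2l.
  apply: le_lt_trans h2 _; apply: le_lt_trans h.
  by rewrite mulrDr mulr1 mulrC lerDl.
have h4 : - ((f1 c - f1 z) * f1 z) <= `|f1 c - f1 z| * `|f1 z|.
  by rewrite -normrM -normrN ler_norm.
have h6 : `|f1 c - f1 z| * `|f1 z| < f1 z ^+ 2.
  by rewrite -[ltRHS]real_normK ?num_real// expr2 ltr_pM2r// normr_gt0.
have -> : f1 c * f1 z = f1 z ^+ 2 - - ((f1 c - f1 z) * f1 z) by ring.
by rewrite subr_gt0 (le_lt_trans h4).
Qed.

(** Finitely many simple zeros share a radius [del] on which the sign of [f] is controlled. Once the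
    mesh is below [del], no cell holds two zeros and the ends of a cell holding one have opposite
    signs; nonvanishing at the grid points rules out a zero at an end. *)
Lemma sign_changes_ge : finite_set (period_zeros f) ->
  (forall z, period_zeros f z -> f1 z != 0) ->
  exists n0, forall n, (n0 <= n)%N -> (forall j, f (grid n j) != 0) ->
  (#|` fset_set (period_zeros f)| <= sign_changes f n)%N.
Proof.
move=> fin nd.
have [del del0 delP] : exists2 del : R, 0 < del &
    forall z, period_zeros f z -> del <= `|f1 z| / (C + 1).
  have : forall z, z \in enum_fset (fset_set (period_zeros f)) -> f1 z != 0.
    move=> z zZ; apply: nd; apply: set_mem.
    by rewrite -in_fset_set.
  have : forall z, period_zeros f z -> z \in enum_fset (fset_set (period_zeros f)).
    move=> z zZ; suff : z \in fset_set (period_zeros f) by [].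
    by rewrite in_fset_set//; exact: mem_set.
  move: (enum_fset _) => s sP.
  suff : (forall z, z \in s -> f1 z != 0) -> exists2 del : R, 0 < del &
      forall z, z \in s -> del <= `|f1 z| / (C + 1).
    by move=> H /H[del ? dP]; exists del => // z /sP /dP.
  elim: s {sP} => [|y s IH] ys; first by exists 1.
  have [del del0 dP] := IH (fun z zs => ys z (mem_behead (s := y :: s) zs)).
  have C1 : 0 < C + 1 by rewrite ltr_wpDl.
  exists (Num.min del (`|f1 y| / (C + 1))).
    by rewrite lt_min del0 divr_gt0// normr_gt0 ys// mem_head.
  move=> z; rewrite inE => /predU1P[->|/dP dz]; first by rewrite ge_min lexx orbT.
  by rewrite ge_min dz.
exists (Num.truncn (2 * pi / del)).+1 => n nn fg.
have n0 : (0 < n)%N by rewrite (leq_trans _ nn).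
have hn : 2 * pi / n%:R < del.
  rewrite ltr_pdivrMr ?ltr0n// [ltRHS]mulrC -ltr_pdivrMr//.
  by apply: lt_le_trans (truncnS_gt _) _; rewrite ler_nat.
have near z x : period_zeros f z -> 0 < `|x - z| < del -> 0 < f x * ((x - z) * f1 z).
  move=> zZ /andP[h1 h2]; apply: simple_zero_sign; [exact: zZ.2|exact: nd|].
  by rewrite h1 (lt_le_trans h2)// delP.
pose sc (j : 'I_n) := f (grid n j) * f (grid n j.+1) < 0.
have -> : sign_changes f n = #|sc|.
  by rewrite -sum1_card /sign_changes [RHS]big_mkcond.
pose Z := enum_fset (fset_set (period_zeros f)).
have ZP z : z \in Z -> period_zeros f z.
  by move=> zZ; apply: set_mem; rewrite -in_fset_set.
have /choice[J JP] z : exists j : 'I_n, z \in Z -> grid n j <= z < grid n j.+1.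
  have [zZ|zZ] := boolP (z \in Z); last by exists (Ordinal n0).
  by have [j jP] := grid_locate n0 (ZP z zZ).1; exists j.
rewrite cardE -(size_map J); apply: uniq_leq_size.
  rewrite map_inj_in_uniq ?fset_uniq// => y z yZ zZ Jyz.
  (* Two zeros in one cell are closer than [del], so the sign rule around [z] would give
     [f y != 0]. *)
  apply/eqP; rewrite -subr_eq0; apply/negP => /negP yz.
  have /andP[y1 y2] := JP y yZ; have /andP[z1 z2] := JP z zZ.
  rewrite Jyz grid_step in y1 y2; rewrite grid_step in z2.
  have := near z y (ZP z zZ); rewrite (ZP y yZ).2 mul0r ltxx normr_gt0 yz/=.
  have -> : `|y - z| < del; last by move=> /(_ isT).
  by apply: le_lt_trans hn; rewrite ler_norml; apply/andP; split; lra.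
move=> j /mapP[z zZ ->]; rewrite mem_enum /sc.
have /andP[z1 z2] := JP z zZ.
have {}z1 : grid n (J z) < z.
  rewrite lt_def z1 andbT; apply: contraTneq (fg (J z)) => <-.
  by rewrite (ZP z zZ).2 eqxx.
have h1 : 0 < `|grid n (J z) - z| < del.
  rewrite grid_step in z2; rewrite ltr0_norm; last lra.
  by apply/andP; split; lra.
have h2 : 0 < `|grid n (J z).+1 - z| < del.
  by rewrite gtr0_norm; last lra; rewrite grid_step in z2 *; apply/andP; split; lra.
have p1 := near z _ (ZP z zZ) h1; have p2 := near z _ (ZP z zZ) h2.
rewrite -topredE/= /sc.
move: p1 p2; move: (f (grid n (J z))) (f (grid n (J z).+1)) (f1 z) => u v w p1 p2.
(* The left end lies before the zero and the right end after it: [u] has the sign opposite to the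
   derivative [w], and [v] has its sign. *)
have a1 : u * w < 0.
  have -> : u * w = (u * ((grid n (J z) - z) * w)) / (grid n (J z) - z).
    by field; rewrite subr_eq0 lt_eqF.
  by rewrite pmulr_rlt0// invr_lt0 subr_lt0.
have a2 : 0 < v * w.
  have -> : v * w = (v * ((grid n (J z).+1 - z) * w)) / (grid n (J z).+1 - z).
    by field; rewrite subr_eq0 gt_eqF.
  by rewrite pmulr_rgt0// invr_gt0 subr_gt0.
have : (u * w) * (v * w) < 0 by rewrite nmulr_rlt0.
have -> : (u * w) * (v * w) = w ^+ 2 * (u * v) by ring.
rewrite pmulr_rlt0// exprn_even_gt0//=.
by apply: contraTneq a2 => ->; rewrite mulr0 ltxx.
Qed.

End second_derivative.
End sign_changes.

Section trig_derivative.
Context {R : realType}.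

Lemma is_derive_sumf n (F dF : 'I_n -> R -> R) (x : R) :
  (forall i, is_derive x 1 (F i) (dF i x)) ->
  is_derive x 1 (fun t => \sum_(i < n) F i t) (\sum_(i < n) dF i x).
Proof.
elim: n F dF => [|n IH] F dF H.
  rewrite big_ord0 (_ : (fun _ => _) = cst 0); first exact: is_derive_cst.
  by apply/funext => t; rewrite big_ord0.
rewrite big_ord_recl (_ : (fun _ => _) =
  F ord0 \+ (fun t => \sum_(i < n) F (lift ord0 i) t)); last first.
  by apply/funext => t; rewrite big_ord_recl.
have H' := IH (fun i => F (lift ord0 i)) (fun i => dF (lift ord0 i)) (fun i => H _).
exact: (is_deriveD (H ord0) H').
Qed.

Lemma is_derive_trig m (al be : 'I_(m.*2.+1) -> R) (x : R) :
  is_derive x 1 (trig al be)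
    (trig (fun j => (freq j)%:~R * be j) (fun j => - ((freq j)%:~R * al j)) x).
Proof.
apply: (@is_derive_sumf _ (fun j t => al j * cos ((freq j)%:~R * t) + be j * sin ((freq j)%:~R * t))
  (fun j t => (freq j)%:~R * be j * cos ((freq j)%:~R * t)
    + - ((freq j)%:~R * al j) * sin ((freq j)%:~R * t))) => j.
have c := is_deriveZ (al j) (is_derive_cos_affine (freq j)%:~R 0 x).
have s := is_deriveZ (be j) (is_derive_sin_affine (freq j)%:~R 0 x).
have cE : (fun t : R => cos ((freq j)%:~R * t + 0)) = (fun t => cos ((freq j)%:~R * t)).
  by apply/funext => t; rewrite addr0.
have sE : (fun t : R => sin ((freq j)%:~R * t + 0)) = (fun t => sin ((freq j)%:~R * t)).
  by apply/funext => t; rewrite addr0.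
rewrite cE addr0 in c; rewrite sE addr0 in s.
by apply: (is_derive_eq (is_deriveD c s)); rewrite /GRing.scale/=; ring.
Qed.

Lemma trig_bounded m (al be : 'I_(m.*2.+1) -> R) (x : R) :
  `|trig al be x| <= \sum_(j < m.*2.+1) (`|al j| + `|be j|).
Proof.
apply: (le_trans (ler_norm_sum _ _ _)); apply: ler_sum => j _.
apply: (le_trans (ler_normD _ _)); rewrite !normrM.
by apply: lerD; rewrite -[leRHS]mulr1 ler_wpM2l// ?cos_max ?sin_max.
Qed.

End trig_derivative.

(** * Roots on the circle as zeros over one period *)

Section counting_zeros.
Local Open Scope complex_scope.
Context {R : realType}.

Lemma cos_eq1 (x : R) : 0 <= x < 2 * pi -> cos x = 1 -> x = 0.
Proof.
move=> /andP[x0 x2]; rewrite -cos0 => E.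
have [xpi|pix] := leP x pi.
  by apply: cos_inj E; rewrite in_itv/= ?lexx ?x0 ?pi_ge0.
have E2 : cos (2 * pi - x) = cos 0.
  by rewrite -E mulr_natl addrC cosD2pi cosN.
have := cos_inj _ _ E2; rewrite !in_itv/= lexx pi_ge0 => /(_ _ isT) H.
have : 2 * pi - x = 0 by apply: H; apply/andP; split; lra.
by move=> H2; exfalso; lra.
Qed.

Lemma cis_inj : {in [set t : R | 0 <= t < 2 * pi] &, injective (@cis R)}.
Proof.
move=> s t /[!inE] /= /andP[s0 s2] /andP[t0 t2].
wlog st : s t s0 s2 t0 t2 / s <= t.
  move=> W; have [st|/ltW ts] := leP s t; first exact: W.
  by move=> /esym E; apply/esym; exact: W.
move=> [cE sE]; apply/eqP; rewrite eq_sym -subr_eq0; apply/eqP.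
apply: cos_eq1; first by apply/andP; split; lra.
by rewrite cosB cE sE -!expr2 cos2Dsin2.
Qed.

Lemma cis_surj (z : R[i]) : `|z| = 1 -> exists2 t, 0 <= t < 2 * pi & cis t = z.
Proof.
case: z => x y; rewrite normc_def/= => -[xy1].
have {}xy1 : x ^+ 2 + y ^+ 2 = 1.
  by rewrite -[LHS]sqr_sqrtr ?addr_ge0 ?sqr_ge0// xy1 expr1n.
have x1 : -1 <= x <= 1.
  rewrite -ler_norml -(@expr_le1 _ 2)// real_normK ?num_real//.
  by rewrite -xy1 lerDl sqr_ge0.
have pi0 := @pi_gt0 R.
have a0 := acos_ge0 x1; have api := acos_lepi x1.
have sy : sin (acos x) = `|y|.
  by rewrite sin_acos// (_ : 1 - x ^+ 2 = y ^+ 2) ?sqrtr_sqr// -xy1; ring.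
have [y0|y0] := leP 0 y.
  exists (acos x); first by apply/andP; split => //; lra.
  by rewrite /cis sy acosK ?in_itv//= ger0_norm.
have a_gt0 : 0 < acos x.
  rewrite lt_def a0 andbT; apply: contraTneq y0 => E.
  by move: sy; rewrite E sin0 => /esym/eqP; rewrite normr_eq0 => /eqP ->; rewrite ltxx.
exists (2 * pi - acos x); first by apply/andP; split; lra.
rewrite /cis mulr_natl addrC cosD2pi sinD2pi cosN sinN sy acosK ?in_itv//=.
by rewrite ltr0_norm// opprK.
Qed.

Lemma real_rootsE m (a : laurent R m) : real_laurent a ->
  real_roots a = @cis R @` period_zeros (restr_circle a).
Proof.
move=> ra; apply/seteqP; split => z.
  move=> [[z0 az]] /cis_surj[t t2 tz]; exists t => //; split => //.
  by move: az; rewrite -tz real_laurent_cis// => -[].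
move=> [t [t2 ft] <-]; split; last exact: cis_norm.
by split; [exact: cis_neq0|rewrite real_laurent_cis// ft].
Qed.

Lemma nb_real_rootsE m (a : laurent R m) : real_laurent a ->
  finite_set (laurent_roots a) ->
  finite_set (period_zeros (restr_circle a)) /\
  nb_real_roots a = (#|` fset_set (period_zeros (restr_circle a))|%:R)%:E.
Proof.
move=> ra fin.
have finr : finite_set (real_roots a) by apply: sub_finite_set fin => z [].
have inj : {in period_zeros (restr_circle a) &, injective (@cis R)}.
  move=> s t /set_mem[s2 _] /set_mem[t2 _].
  by apply: cis_inj; exact: mem_set.
have E := inj_card_eq inj; rewrite -real_rootsE// in E.
have finz : finite_set (period_zeros (restr_circle a)).
  by rewrite -(eq_finite_set E).
split=> //; rewrite /nb_real_roots /counting asboolT//; congr (_%:R)%:E.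
by apply/fcard_eq.
Qed.

End counting_zeros.

(** * The angle between consecutive grid values *)

Section angle_limit.
Context {R : realType}.

(** A division-free form of [sin y / y -> 1]: [c] tends to 0 with [y]. *)
Lemma sin_mean (y : R) : exists c, `|c| <= `|y| /\ sin y = cos c * y.
Proof.
have [c [cy E]] := mean_value (@is_derive_sin R) y 0.
by exists c; rewrite !subr0 sin0 subr0 in cy E *.
Qed.

Lemma cvg_div_nat (x : R) : (fun n : nat => x / n.+2%:R) @ \oo --> (0 : R).
Proof.
rewrite -(mulr0 x); apply: cvgMl_tmp.
rewrite (_ : (fun _ => _) = (fun n => harmonic (n + 1)%N)); last first.
  by apply/funext => n; rewrite /harmonic/= addn1.
by rewrite (cvg_shiftn 1); exact: cvg_harmonic.
Qed.

Lemma cvg_norm_le (u v : nat -> R) : (forall n, `|u n| <= `|v n|) ->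
  v @ \oo --> (0 : R) -> u @ \oo --> (0 : R).
Proof.
move=> uv /cvgr0Pnorm_le vP; apply/cvgr0Pnorm_le => e /vP.
by apply: filterS => n; exact: le_trans.
Qed.

Lemma cvg_cos0 (c : nat -> R) : c @ \oo --> (0 : R) ->
  (fun n => cos (c n)) @ \oo --> (1 : R).
Proof. by move=> c0; rewrite -cos0; apply: continuous_cvg c0; exact: continuous_cos. Qed.

Lemma cvg_scaled_sin (x : R) :
  (fun n : nat => n.+2%:R * sin (x / n.+2%:R)) @ \oo --> x.
Proof.
have /choice[c cP] (n : nat) := sin_mean (x / n.+2%:R).
have c0 : c @ \oo --> (0 : R).
  by apply: (cvg_norm_le _ (cvg_div_nat x)) => n; have [] := cP n.
rewrite (_ : (fun _ => _) = fun n => cos (c n) * x); last first.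
  apply/funext => n; have [_ ->] := cP n.
  by rewrite mulrCA; congr (_ * _); rewrite mulrC divfK.
rewrite -[X in _ --> X](mul1r x); apply: cvgMr_tmp; exact: cvg_cos0.
Qed.

Lemma cvg_sumf n (u : 'I_n -> nat -> R) (l : 'I_n -> R) :
  (forall i, u i @ \oo --> l i) ->
  (fun k => \sum_(i < n) u i k) @ \oo --> \sum_(i < n) l i.
Proof.
elim: n u l => [|n IH] u l H.
  rewrite big_ord0 (_ : (fun _ => _) = cst 0); first exact: cvg_cst.
  by apply/funext => k; rewrite big_ord0.
rewrite big_ord_recl (_ : (fun _ => _) =
  (fun k => u ord0 k + \sum_(i < n) u (lift ord0 i) k)); last first.
  by apply/funext => k; rewrite big_ord_recl.
by apply: cvgD; [exact: H|apply: IH => i; exact: H].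
Qed.

Variable m : nat.
Hypothesis m0 : (1 <= m)%N.

(** The Dirichlet kernel divided by its value on the diagonal. *)
Definition correlation (h : R) : R :=
  (\sum_(j < m.*2.+1) cos ((freq j)%:~R * h)) / m.*2.+1%:R.

Let N0 : 0 < m.*2.+1%:R :> R.
Proof. by rewrite ltr0n. Qed.

(** The half-angle formula turns the second-order behaviour of [correlation] at 0 into the
    first-order behaviour of sines. *)
Let corr_sin (h : R) : 1 - correlation h =
  2 * ((\sum_(j < m.*2.+1) sin ((freq j)%:~R * (h / 2)) ^+ 2) / m.*2.+1%:R).
Proof.
have cos_half (x : R) : cos x = 1 - 2 * sin (x / 2) ^+ 2.
  rewrite [in LHS](_ : x = x / 2 + x / 2); last by field.
  by rewrite cosD -!expr2 cos2sin2; ring.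
rewrite /correlation (eq_bigr (fun j => 1 - 2 * sin ((freq j)%:~R * (h / 2)) ^+ 2)); last first.
  by move=> j _; rewrite cos_half -mulrA.
rewrite sumrB -mulr_sumr sumr_const card_ord.
by field; rewrite ?lt0r_neq0.
Qed.

Lemma correlation_lt1 h : 0 < h < 2 * pi -> correlation h < 1.
Proof.
move=> /andP[h0 h2]; rewrite /correlation ltr_pdivrMr// mul1r.
rewrite -[ltRHS](_ : \sum_(j < m.*2.+1) 1 = _); last by rewrite sumr_const card_ord.
(* Index [m + 1] carries frequency 1, present because [1 <= m]; its cosine is below 1 strictly
   inside the period. *)
have j1 : (m.+1 < m.*2.+1)%N by rewrite ltnS -addnn -[X in (X < _)%N]addn0 ltn_add2l.
rewrite (bigD1 (Ordinal j1))//= [ltRHS](bigD1 (Ordinal j1))//= ltr_leD//; last first.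
  by apply: ler_sum => j _; exact: cos_le1.
rewrite /freq/= -addn1 PoszD addrAC subrr add0r mul1r lt_neqAle cos_le1 andbT.
have hI : 0 <= h < 2 * pi by rewrite h2 andbT ltW.
by apply/eqP => /(cos_eq1 hI) E; move: h0; rewrite E ltxx.
Qed.

Lemma correlation_gtN1 h : -1 < correlation h.
Proof.
rewrite /correlation ltr_pdivlMr// mulN1r.
rewrite -[ltLHS](_ : \sum_(j < m.*2.+1) (-1) = _); last first.
  by rewrite sumr_const card_ord mulNrn.
have j0 : (m < m.*2.+1)%N by rewrite ltnS -addnn leq_addr.
rewrite (bigD1 (Ordinal j0))//= [ltRHS](bigD1 (Ordinal j0))//= ltr_leD//; last first.
  by apply: ler_sum => j _; exact: cos_geN1.
by rewrite /freq/= subrr mul0r cos0; lra.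
Qed.

Definition step_angle (n : nat) : R := acos (correlation (2 * pi / n%:R)).

(** From two grid points on, the mesh is less than a full turn and the correlation lies strictly
    between -1 and 1; with a single point it would be 1. *)
Lemma step_angleP n : 0 < step_angle n.+2 < pi /\
  cos (step_angle n.+2) = correlation (2 * pi / n.+2%:R).
Proof.
have pi0 : 0 < 2 * pi :> R by rewrite mulr_gt0// pi_gt0.
have h : 0 < 2 * pi / (n.+2%:R : R) < 2 * pi.
  rewrite divr_gt0//= ltr_pdivrMr// -[ltLHS]mulr1 ltr_pM2l//.
  by rewrite (_ : 1 = 1%:R)// ltr_nat.
have h1 := correlation_lt1 h; have h2 := correlation_gtN1 (2 * pi / n.+2%:R).
split; last by rewrite acosK// in_itv/= !ltW.
by rewrite acos_gt0 ?h1 ?(ltW h2)// acos_ltpi// h2 ltW.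
Qed.

Lemma sum_freq_sqr : \sum_(j < m.*2.+1) ((freq j)%:~R : R) ^+ 2 =
  m.*2.+1%:R * ((m * m.+1)%:R / 3).
Proof.
have gen n (c : R) : \sum_(j < n) (j%:R - c) ^+ 2 =
    n%:R * (n%:R - 1) * (2 * n%:R - 1) / 6 - c * n%:R * (n%:R - 1) + n%:R * c ^+ 2.
  elim: n => [|n IH]; first by rewrite big_ord0; field.
  by rewrite big_ord_recr/= IH -addn1 natrD; field.
rewrite (eq_bigr (fun j : 'I_(m.*2.+1) => (j%:R - m%:R) ^+ 2)); last first.
  by move=> j _; rewrite /freq intrB.
by rewrite gen natrM -[m.+1]addn1 -[m.*2.+1]addn1 !natrD -mul2n natrM; field.
Qed.

(** Half the angle, [y n], satisfies [sin (y n) ^ 2 =] mean of [sin (k pi / n) ^ 2] at the grid size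
    [n.+2], so the scaled sine [S n] tends to [pi] times the root mean square frequency. As [y n]
    tends to 0, replacing the sine by its argument does not change the limit. *)
Lemma cvg_step_angle :
  (fun n => n.+2%:R * (step_angle n.+2 / pi)) @ \oo -->
  (2 * Num.sqrt ((m * m.+1)%:R / 3) : R).
Proof.
have pi0 := @pi_gt0 R.
pose y n := step_angle n.+2 / 2.
pose S (n : nat) : R := Num.sqrt ((\sum_(j < m.*2.+1)
  (n.+2%:R * sin ((freq j)%:~R * pi / n.+2%:R)) ^+ 2) / m.*2.+1%:R).
have yI n : 0 <= y n <= pi / 2.
  have [/andP[a0 api] _] := step_angleP n.
  by rewrite /y; apply/andP; split; [lra|rewrite ler_pM2r// ltW].
have sinyE n : n.+2%:R * sin (y n) = S n.
  have siny0 : 0 <= sin (y n).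
    by apply: sin_ge0_pi; have /andP[? ?] := yI n; apply/andP; split; lra.
  rewrite /S -[LHS]ger0_norm ?mulr_ge0// -sqrtr_sqr; congr Num.sqrt.
  under eq_bigr do rewrite exprMn; rewrite -mulr_sumr exprMn -mulrA; congr (_ * _).
  have [_ E] := step_angleP n.
  have := corr_sin (2 * pi / n.+2%:R); rewrite -E.
  have -> : 2 * pi / n.+2%:R / 2 = pi / n.+2%:R :> R.
    by rewrite mulrAC [2 * _]mulrC mulfK.
  have -> : 1 - cos (step_angle n.+2) = 2 * sin (y n) ^+ 2.
    rewrite (_ : step_angle n.+2 = y n + y n); last by rewrite /y; field.
    by rewrite cosD -!expr2 cos2sin2; ring.
  move=> /(mulfI (lt0r_neq0 (ltr0Sn _ 1))) ->; congr (_ / _).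
  by apply: eq_bigr => j _; rewrite mulrA.
have cvgS : S @ \oo --> pi * Num.sqrt ((m * m.+1)%:R / 3).
  have -> : pi * Num.sqrt ((m * m.+1)%:R / 3) =
      Num.sqrt ((\sum_(j < m.*2.+1) ((freq j)%:~R * pi) ^+ 2) / m.*2.+1%:R) :> R.
    under eq_bigr do rewrite exprMn.
    rewrite -mulr_suml sum_freq_sqr.
    have gen (a b c : R) : c != 0 -> c * a * b / c = b * a by move=> ?; field.
    rewrite gen ?lt0r_neq0//.
    by rewrite [RHS]sqrtrM ?sqr_ge0// sqrtr_sqr gtr0_norm.
  apply: (continuous_cvg _ (@sqrt_continuous R _)).
  apply: cvgMr_tmp; apply: cvg_sumf => j.
  by apply: cvgM; exact: cvg_scaled_sin.
have y0 : y @ \oo --> (0 : R).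
  (* That [y] tends to 0 comes from the continuity of [asin]: [sin (y n)] is the convergent [S n]
     over the grid size. *)
  have -> : y = asin \o (fun n => S n / n.+2%:R).
    apply/funext => n /=; rewrite -sinyE mulrC mulKf ?pnatr_eq0//.
    rewrite sinK// in_itv/=; have /andP[? ?] := yI n; apply/andP; split => //; lra.
  have asin0 : asin (0 : R) = 0.
    by rewrite -[in LHS]sin0 sinK// in_itv/=; apply/andP; split; lra.
  rewrite -asin0; apply: continuous_cvg.
    by apply: continuous_asin; apply/andP; split; lra.
  rewrite -(mulr0 (pi * Num.sqrt ((m * m.+1)%:R / 3))); apply: cvgM => //.
  by have := cvg_div_nat 1; under eq_fun do rewrite mul1r.
have /choice[c cP] (n : nat) := sin_mean (y n).
have c1 : (fun n => cos (c n)) @ \oo --> (1 : R).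
  by apply: cvg_cos0; apply: (cvg_norm_le _ y0) => n; have [] := cP n.
have yE : \forall n \near \oo, n.+2%:R * (step_angle n.+2 / pi) =
    2 / pi * (S n * (cos (c n))^-1).
  have cpos : \forall n \near \oo, 0 < cos (c n).
    exact: (cvgr_gt (1 : R) c1 0 ltr01).
  apply: filterS cpos => n cn0; have [_ E] := cP n.
  have gen (N a p q : R) : q != 0 -> p != 0 ->
    N * (a / p) = 2 / p * (N * (q * (a / 2)) * q^-1).
    by move=> q0 p0; field; rewrite ?q0 ?p0.
  by rewrite -sinyE E; apply: gen; rewrite lt0r_neq0.
rewrite (_ : 2 * _ = 2 / pi * (pi * Num.sqrt ((m * m.+1)%:R / 3) * 1^-1)); last first.
  by rewrite invr1 mulr1 mulrA divfK// lt0r_neq0.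
apply: cvg_trans (near_eq_cvg _) _; last first.
  apply: cvgMl_tmp; apply: cvgM; first exact: cvgS.
  by apply: cvgV c1; exact: oner_neq0.
by apply: filterS yE => n ->.
Qed.
End angle_limit.

(** * The expected number of real roots *)

Section integral_null_complement.
Context d (T : measurableType d) (R : realType) (P : {measure set T -> \bar R}).
Import HBNNSimple.

(** The integral of a nonnegative function is a supremum over the simple functions below it, and
    this is monotone for arbitrary functions. *)
Lemma ge0_le_integral_any (f g : T -> \bar R) : (forall x, 0 <= f x)%E ->
  (forall x, f x <= g x)%E -> (\int[P]_x f x <= \int[P]_x g x)%E.
Proof.
move=> f0 fg; have g0 x : (0 <= g x)%E by exact: le_trans (fg x).
rewrite !ge0_integralTE//; apply: ereal_sup_le => _ [h hf <-].
by exists h => // x; exact: le_trans (hf x) (fg x).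
Qed.

(* The root counts below are only known to be measurable on an event of
   probability one. *)
Lemma integral_null_complement (D : set T) (f : T -> \bar R) :
  measurable D -> P (~` D) = 0%E -> measurable_fun D f ->
  (forall x, 0 <= f x)%E -> (\int[P]_x f x = \int[P]_(x in D) f x)%E.
Proof.
move=> mD PD mf f0; apply/eqP; rewrite eq_le; apply/andP; split; last first.
  rewrite integral_mkcond; apply: ge0_le_integral_any => x; rewrite patchE;
    by case: ifP.
(* Extending by [+oo] off [D] gives a measurable function above [f], and the null set hides the
   infinite values. *)
pose g x := if x \in D then f x else +oo%E.
have gD x : D x -> g x = f x by move=> Dx; rewrite /g mem_set.
have g0 x : (0 <= g x)%E by rewrite /g; case: ifP.
have mg : measurable_fun [set: T] g.
  rewrite -(setvU D); apply/measurable_funU => //; first exact: measurableC.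
  split.
    apply: (eq_measurable_fun (cst +oo%E)) => // x /set_mem Dx.
    by rewrite /g memNset.
  by apply: (eq_measurable_fun f) => // x /set_mem Dx; rewrite gD.
apply: (@le_trans _ _ (\int[P]_x g x)%E).
  by apply: ge0_le_integral_any => // x; rewrite /g; case: ifP => // _; exact: leey.
rewrite (ge0_negligible_integral (measurableC mD) measurableT mg)//.
rewrite setTD setCK le_eqVlt; apply/orP; left; apply/eqP.
by apply: eq_integral => x /set_mem; exact: gD.
Qed.

End integral_null_complement.

Section random_laurent.
Context d (T : measurableType d) (R : realType) (P : probability T R).
Variables (m : nat) (F : T -> laurent R m).
Hypothesis m0 : (1 <= m)%N.
Hypothesis Freal : forall w, real_laurent (F w).
Variables (n : nat) (e : 'I_n -> R -> R) (xi : 'I_n -> {RV P >-> R}).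
Hypothesis eB : orthonormal_basis (@Trig R m) e.
Hypothesis xi_indep : mutually_independent xi.
Hypothesis xi_law : forall i (A : set R), measurable A ->
  distribution P (xi i) A = normal_prob 0 1 A.
Hypothesis FE : forall w t, restr_circle (F w) t = \sum_(i < n) xi i w * e i t.

Let f w t := restr_circle (F w) t.

Let fE w t : f w t = \sum_(i < n) e i t * xi i w.
Proof. by rewrite /f FE; apply: eq_bigr => i _; rewrite mulrC. Qed.

Let measurable_f t : measurable_fun [set: T] (f ^~ t).
Proof.
have -> : f ^~ t = (fun w => \sum_(i < n) e i t * xi i w).
  by apply/funext => w; exact: fE.
by apply: measurable_sum => i; exact: measurable_funM.
Qed.

Let pi2_gt0 : 0 < 2 * pi :> R.
Proof. by rewrite mulr_gt0// pi_gt0. Qed.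

(** The variance of [f] at any point, equal to [(2 m + 1) / (2 pi)]. *)
Let K : R := dirichlet m 0 0.

Let KE t : dirichlet m t t = K.
Proof.
by rewrite /K /dirichlet; congr (_ * _); apply: eq_bigr => j _; rewrite !subrr.
Qed.

Let K_gt0 : 0 < K.
Proof.
rewrite /K /dirichlet mulr_gt0 ?invr_gt0//.
rewrite (eq_bigr (fun=> 1)) => [|j _]; last by rewrite subrr mulr0 cos0.
by rewrite sumr_const card_ord ltr0n.
Qed.

Let e_sqr t : \sum_(i < n) e i t ^+ 2 = K.
Proof.
rewrite -(KE t) -(orthonormal_kernel eB); apply: eq_bigr => i _.
by rewrite expr2.
Qed.

Let grid_null t : P [set w | f w t = 0] = 0%E.
Proof.
rewrite -(gaussian_null xi_indep xi_law (e_sqr t) K_gt0).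
by congr (P _); apply/funext => w /=; rewrite fE.
Qed.

Let grid_small t (del : R) : 0 <= del ->
  (P [set w | `|f w t| <= del]%R <= (2 * (del / Num.sqrt K))%:E)%E.
Proof.
move=> del0; have := gaussian_small_ball xi_indep xi_law (e_sqr t) K_gt0 del0.
by congr (P _ <= _)%E; apply/funext => w /=; rewrite fE.
Qed.

Let change k j : set T := [set w | f w (grid k j) * f w (grid k j.+1) < 0].

Let measurable_change k j : measurable (change k j).
Proof.
rewrite -[change k j]setTI; apply: measurable_fun_ltr => //.
by apply: measurable_funM; exact: measurable_f.
Qed.

Let P_change k j : P (change k.+2 j) = (step_angle m k.+2 / pi)%:E.
Proof.
have [aI cosa] := @step_angleP R m m0 k.
have uv : \sum_(i < n) e i (grid k.+2 j.+1) * e i (grid k.+2 j) =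
    K * cos (step_angle m k.+2).
  rewrite (orthonormal_kernel eB) cosa grid_step /K /dirichlet /correlation.
  rewrite addrAC subrr add0r (eq_bigr (fun=> 1) (r := index_enum 'I_(m.*2.+1))
    (F1 := fun j => cos ((freq j)%:~R * (0 - 0)))) => [|i _]; last first.
    by rewrite subrr mulr0 cos0.
  rewrite sumr_const card_ord.
  have gen (a N S : R) : N != 0 -> a * S = a * N * (S / N) by move=> ?; field.
  by apply: gen; rewrite pnatr_eq0.
rewrite -(gaussian_sign_change xi_indep xi_law (e_sqr _) (e_sqr _) K_gt0 uv aI).
by congr (P _); apply/funext => w; rewrite /change/= !fE mulrC.
Qed.

Let f' w : R -> R := trig (fun j => (freq j)%:~R * - complex.Im (F w j))
                          (fun j => - ((freq j)%:~R * complex.Re (F w j))).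

Let df w (t : R) : is_derive t 1 (f w) (f' w t).
Proof. by rewrite /f restr_circleE; exact: is_derive_trig. Qed.

Let f'' w : R -> R :=
  trig (fun j => (freq j)%:~R * - ((freq j)%:~R * complex.Re (F w j)))
       (fun j => - ((freq j)%:~R * ((freq j)%:~R * - complex.Im (F w j)))).

Let df' w (t : R) : is_derive t 1 (f' w) (f'' w t).
Proof. exact: is_derive_trig. Qed.

(** The bound is a natural number so that the samples with a double zero are covered by countably
    many events, one for each [C]. *)
Let f''_bound w : exists C : nat, forall t, `|f'' w t| <= C%:R.
Proof.
eexists (Num.truncn _).+1 => t; apply: le_trans (trig_bounded _ _ _) _.
by apply/ltW; exact: truncnS_gt.
Qed.

Let double_zero : set T :=
  [set w | exists z, [/\ 0 <= z < 2 * pi, f w z = 0 & f' w z = 0]].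

(* A double zero forces a value O(1/k^2) at one of the k points of the grid,
   an event of probability O(1/k). *)
Let negligible_double_zero : P.-negligible double_zero.
Proof.
pose Z (C k j : nat) : set T :=
  [set w | `|f w (grid k j)| <= C%:R * (2 * pi / k%:R) ^+ 2].
have mZ C k j : measurable (Z C k j).
  rewrite -[Z C k j]setTI; apply: measurable_fun_ler => //.
  by apply: measurableT_comp => //; exact: measurable_f.
pose Y C := \bigcap_k \big[setU/set0]_(j < k.+1) Z C k.+1 j.
have mYk C k : measurable (\big[setU/set0]_(j < k.+1) Z C k.+1 j).
  by apply: bigsetU_measurable => j _; exact: mZ.
have mY C : measurable (Y C) by exact: bigcapT_measurable.
apply: (@negligibleS _ _ _ _ (\bigcup_C Y C)).
  move=> w [z [zI fz f'z]]; have [C CP] := f''_bound w; exists C => // k _.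
  have [j jP] := double_zero_grid (df w) (df' w) CP (ltn0Sn k) zI fz f'z.
  by rewrite -bigcup_mkord; exists j => //=; exact: ltn_ord.
apply: negligible_bigcup => C; apply/negligibleP => //.
apply/eqP; rewrite eq_le measure_ge0 andbT.
(* Union bound over [k + 1] points, each of probability at most
   [2 C (2 pi / (k + 1)) ^ 2 / sqrt K]. *)
pose A : R := 2 * C%:R * (2 * pi) ^+ 2 / Num.sqrt K.
have bound k : (P (Y C) <= (A / k.+1%:R)%:E)%E.
  apply: (@le_trans _ _ (P (\big[setU/set0]_(j < k.+1) Z C k.+1 j))).
    by apply: le_measure; rewrite ?inE//; exact: bigcap_inf.
  apply: le_trans (Boole_inequality _ _) _ => //.
  apply: (@le_trans _ _ (\sum_(j < k.+1)
      (2 * (C%:R * (2 * pi / k.+1%:R) ^+ 2 / Num.sqrt K))%:E)%E).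
    apply: lee_sum => j _; apply: grid_small.
    by rewrite mulr_ge0// sqr_ge0.
  rewrite sumEFin lee_fin sumr_const card_ord -[leLHS]mulr_natr /A.
  have sK : Num.sqrt K != 0 by rewrite gt_eqF// sqrtr_gt0.
  rewrite le_eqVlt; apply/orP; left; apply/eqP.
  have k0 : k.+1%:R != 0 :> R by rewrite pnatr_eq0.
  move: (2 * pi) (k.+1%:R : R) sK k0 => p q sK q0.
  by field; rewrite ?sK ?q0.
apply/lee_addgt0Pr => eps eps0; rewrite add0e.
apply: le_trans (bound (Num.truncn (A / eps))) _; rewrite lee_fin.
rewrite ler_pdivrMr// mulrC -ler_pdivrMr//.
by apply/ltW; exact: truncnS_gt.
Qed.

Let top w := inner (f w) (fun t => cos (m%:R * t)).

(** [top] is a linear form in the [xi i] whose coefficients are the coordinates of [cosm], so by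
    Parseval its variance is the squared norm of [cos (m t)], namely [pi]. *)
Let negligible_top : P.-negligible [set w | top w = 0].
Proof.
pose cosm (t : R) : R := cos (m%:R * t).
have cosmE : cosm = (fun t => cos (m%:~R * t + 0)).
  by apply/funext => t; rewrite /cosm addr0.
have ccos : continuous cosm by rewrite cosmE; exact: continuous_cos_affine.
have [eT eO eS] := eB.
have ce i : continuous (e i).
  by have [al [be ->]] := eT i; exact: continuous_trig.
have cZ i (c : R) : continuous (fun t => c * e i t).
  by move=> x; apply: cvgMl_tmp; exact: ce.
pose c i := inner (e i) cosm.
have topE w : top w = \sum_(i < n) c i * xi i w.
  rewrite /top (_ : f w = fun t => \sum_(i < n) xi i w * e i t); last first.
    by apply/funext => t; exact: FE.
  rewrite inner_suml//; apply: eq_bigr => i _.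
  by rewrite innerZl// mulrC.
have cosm_trig : Trig m cosm.
  exists (fun j => (j == ord_max)%:R), (fun=> 0); apply/funext => t.
  rewrite (bigD1 ord_max)//= eqxx mul1r mul0r addr0 big1 ?addr0.
    by rewrite freq_max.
  by move=> j /negbTE ->; rewrite !mul0r addr0.
have [b bE] := eS _ cosm_trig.
have bc i : b i = c i.
  rewrite /c innerC bE inner_suml//.
  under eq_bigr do rewrite innerZl// eO.
  rewrite (bigD1 i)//= eqxx mulr1 big1 ?addr0// => j /negbTE ->.
  by rewrite mulr0.
have csqr : \sum_(i < n) c i ^+ 2 = pi.
  transitivity (inner cosm cosm).
    rewrite [X in inner X _]bE inner_suml//; apply: eq_bigr => i _.
    by rewrite innerZl// bc expr2.
  rewrite cosmE inner_cos addr0 subr0 cos0 eqxx.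
  (* For [m = 0] the frequencies [m] and [- m] would coincide and the norm would be different. *)
  have neqN k : (0 < k)%N -> (Posz k == - Posz k) = false by case: k.
  by rewrite neqN// mul0r add0r mulr1 mulr1.
apply: (negligibleS (A := [set w | \sum_(i < n) c i * xi i w = 0])).
  by move=> w /=; rewrite topE.
apply/negligibleP; last exact: (gaussian_null xi_indep xi_law csqr (pi_gt0 R)).
have mt : measurable_fun [set: T] (fun w => \sum_(i < n) c i * xi i w).
  by apply: measurable_sum => i; exact: measurable_funM.
by rewrite -[X in measurable X]setTI; exact: (mt measurableT _ (measurable_set1 0)).
Qed.

Let good_event : exists D : set T, [/\ measurable D, P (~` D) = 0%E &
  forall w, D w -> [/\ forall k j, f w (grid k j) != 0,
    forall z, period_zeros (f w) z -> f' w z != 0 & top w != 0]].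
Proof.
have [N [mN PN NP]] : P.-negligible (\bigcup_k \bigcup_j [set w | f w (grid k j) = 0]
    `|` (double_zero `|` [set w | top w = 0])).
  apply: negligibleU; last exact: negligibleU.
  apply: negligible_bigcup => k; apply: negligible_bigcup => j.
  apply/negligibleP; last exact: grid_null.
  rewrite -[X in measurable X]setTI.
  exact: (measurable_f (grid k j) measurableT (measurable_set1 0)).
exists (~` N); rewrite setCK; split => //; first exact: measurableC.
move=> w wN; split.
- move=> k j; apply/eqP => E; apply: wN; apply: NP; left.
  by exists k => //; exists j.
- move=> z [zI fz]; apply/eqP => E; apply: wN; apply: NP; right; left.
  by exists z.
- by apply/eqP => E; apply: wN; apply: NP; right; right.
Qed.

Let change_count k w : \bar R := \sum_(j < k.+2) (\1_(change k.+2 j) w)%:E.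

Let change_countE k w : change_count k w = ((sign_changes (f w) k.+2)%:R)%:E.
Proof.
rewrite /change_count sumEFin /sign_changes natr_sum; congr EFin.
apply: eq_bigr => j _; rewrite indicE; congr (nat_of_bool _)%:R.
by apply/idP/idP => [/set_mem//|h]; exact: mem_set.
Qed.

Let measurable_change_count k : measurable_fun [set: T] (change_count k).
Proof.
apply: emeasurable_sum => j; apply/measurable_EFinP.
exact: measurable_indic.
Qed.

Let integral_change_count k :
  (\int[P]_w change_count k w = (k.+2%:R * (step_angle m k.+2 / pi))%:E)%E.
Proof.
rewrite ge0_integral_sum//.
rewrite (eq_bigr (fun=> (step_angle m k.+2 / pi)%:E)); last first.
  by move=> j _; rewrite integral_indic// setIT; exact: P_change.
  by rewrite sumEFin sumr_const card_ord mulr_natl.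
by move=> j; apply/measurable_EFinP; exact: measurable_indic.
Qed.

Lemma random_laurent_expectations :
  expected_nb_real_roots P F = (2 * Num.sqrt ((m * m.+1)%:R / 3))%:E /\
  real_root_probability P F = (2 * Num.sqrt ((m * m.+1)%:R / 3) / m.*2%:R)%:E.
Proof.
have [D [mD PD DP]] := good_event.
have extreme w : D w -> F w ord_max != 0 /\ F w ord0 != 0.
  by move=> /DP[_ _ t0]; exact: (real_laurent_extreme (Freal w) t0).
have fin w : D w -> finite_set (laurent_roots (F w)).
  by move=> /extreme[? ?]; exact: finite_laurent_roots.
have nb_le w : D w -> (@nb_real_roots R m (F w) <= (m.*2%:R)%:E)%E.
  by move=> /extreme[? ?]; exact: nb_real_roots_le.
have count_le k w : D w -> (change_count k w <= nb_real_roots (F w))%E.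
  move=> Dw; have [finz ->] := nb_real_rootsE (Freal w) (fin w Dw).
  by rewrite change_countE lee_fin ler_nat; exact: (sign_changes_le (df w)).
have count_cvg w : D w -> change_count^~ w @ \oo --> nb_real_roots (F w).
  move=> Dw; have [finz E] := nb_real_rootsE (Freal w) (fin w Dw).
  have [gnz dnz _] := DP w Dw; have [C CP] := f''_bound w.
  have [k0 k0P] := sign_changes_ge (df w) (df' w) CP finz dnz.
  apply: cvg_near_cst; exists k0 => // k /= k0k; apply/eqP.
  rewrite eq_le count_le//= E change_countE lee_fin ler_nat.
  by apply: k0P => //; rewrite (leq_trans k0k)// -addn2 leq_addr.
have nb0 w : (0 <= @nb_real_roots R m (F w))%E.
  by rewrite /nb_real_roots /counting; case: ifP.
have mcount k : measurable_fun D (change_count k) by exact: measurable_funTS.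
(* On [D] the counts of sign changes are eventually equal to the root count, which inherits their
   measurability. *)
have mnb : measurable_fun D (fun w => @nb_real_roots R m (F w)).
  exact: (emeasurable_fun_cvg _ _ mcount count_cvg).
have cc0 k w : (0 <= change_count k w)%E by rewrite change_countE lee_fin.
have intD : (\int[P]_(w in D) nb_real_roots (F w) =
    (2 * Num.sqrt ((m * m.+1)%:R / 3))%:E)%E.
  have bounded k w : D w -> (`|change_count k w| <= (m.*2%:R)%:E)%E.
    by move=> Dw; rewrite gee0_abs// (le_trans (count_le k w Dw))// nb_le.
  have := dominated_cvg mD mcount count_cvg (g := cst (m.*2%:R)%:E) (fun _ _ => isT)
    (finite_measure_integrable_cst P m.*2%:R mD) bounded.
  rewrite (_ : (fun _ => _) = fun k => (k.+2%:R * (step_angle m k.+2 / pi))%:E); last first.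
    apply/funext => k; rewrite -integral_change_count; apply/esym.
    by apply: integral_null_complement.
  move=> h1; have h2 := @cvg_step_angle R m m0.
  apply: (cvg_unique _ h1) => /=; first exact: ereal_hausdorff.
  by apply: cvg_EFin; [exact: nearW|exact: h2].
have ETnb : (\int[P]_w nb_real_roots (F w) = \int[P]_(w in D) nb_real_roots (F w))%E.
  exact: integral_null_complement.
split; first by rewrite /expected_nb_real_roots ETnb.
rewrite /real_root_probability unlock.
(* On [D] the denominator is the constant [2 m], so the expected ratio is the expected count divided
   by it. *)
have ratioE w : D w -> (real_root_ratio (F w))%:E =
    (nb_real_roots (F w) * ((m.*2%:R)^-1)%:E)%E.
  move=> Dw; have [am a0] := extreme w Dw.
  rewrite /real_root_ratio (nb_rootsE am a0) EFinM fineK//.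
  by have [_ ->] := nb_real_rootsE (Freal w) (fin w Dw).
rewrite (integral_null_complement mD PD); last 2 first.
- apply: (eq_measurable_fun (fun w => nb_real_roots (F w) * ((m.*2%:R)^-1)%:E)%E).
    by move=> w /set_mem Dw; rewrite ratioE.
  by apply: emeasurable_funM.
- move=> w; rewrite lee_fin /real_root_ratio mulr_ge0// fine_ge0//.
rewrite (eq_integral (fun w => nb_real_roots (F w) * ((m.*2%:R)^-1)%:E)%E); last first.
  by move=> w /set_mem Dw; rewrite ratioE.
by rewrite ge0_integralZr// intD.
Qed.

End random_laurent.

Lemma cvg_sqrt_ratio (R : realType) :
  (fun m : nat => Num.sqrt (m.+2%:R / (3 * m.+1%:R) : R)) @ \oo -->
  (1 / Num.sqrt 3 : R).
Proof.
have -> : (fun m : nat => Num.sqrt (m.+2%:R / (3 * m.+1%:R) : R)) =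
    (fun m => Num.sqrt (3^-1 + 3^-1 * harmonic m)).
  apply/funext => m; congr Num.sqrt; rewrite /harmonic/= -[m.+2]addn1 natrD.
  have : m.+1%:R != 0 :> R by rewrite pnatr_eq0.
  by move: (m.+1%:R : R) => x x0; field.
have -> : 1 / Num.sqrt 3 = Num.sqrt (3^-1 + 3^-1 * 0) :> R.
  by rewrite mulr0 addr0 sqrtrV// mul1r.
apply: (continuous_cvg _ (@sqrt_continuous R _)).
by apply: cvgD; [exact: cvg_cst|apply: cvgMl_tmp; exact: cvg_harmonic].
Qed.

Theorem corollary2p1 (R : realType)
    (d : nat -> measure_display)
    (T : forall m : nat, measurableType (d m))
    (P : forall m : nat, probability (T m) R)
    (f : forall m : nat, T m -> laurent R m)
    (hf : forall m : nat, (1 <= m)%N -> random_real_laurent (P m) (f m)) :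
  [/\ forall m : nat, (1 <= m)%N ->
        expected_nb_real_roots (P m) (f m)
        = (2 * Num.sqrt ((m * m.+1)%:R / 3))%:E,
      forall m : nat, (1 <= m)%N ->
        real_root_probability (P m) (f m)
        = (Num.sqrt (m.+1%:R / (3 * m%:R)))%:E &
      (fun m : nat => real_root_probability (P m) (f m)) @ \oo
        --> ((1 / Num.sqrt 3)%:E : \bar R)].
Proof.
have main m : (1 <= m)%N ->
    expected_nb_real_roots (P m) (f m) = (2 * Num.sqrt ((m * m.+1)%:R / 3))%:E /\
    real_root_probability (P m) (f m) = (Num.sqrt (m.+1%:R / (3 * m%:R)))%:E.
  move=> m0; have [fr [n [e [xi [eB xi_indep xi_law fE]]]]] := hf m m0.
  have [E1 E2] := random_laurent_expectations m0 fr eB xi_indep xi_law fE.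
  split; first exact: E1.
  have mR : 0 < m%:R :> R by rewrite ltr0n.
  rewrite E2; congr EFin.
  have -> : m.*2%:R = 2 * m%:R :> R by rewrite -mul2n natrM.
  rewrite -mulf_div divff ?mul1r ?pnatr_eq0//.
  (* Writing [m] as the square root of its square brings the quotient under one root. *)
  have {1}-> : m%:R = Num.sqrt (m%:R ^+ 2) :> R.
    by rewrite sqrtr_sqr ger0_norm// ltW.
  rewrite -sqrtrV ?sqr_ge0// -sqrtrM ?divr_ge0//; congr Num.sqrt; rewrite natrM.
  by move: (m.+1%:R : R) (lt0r_neq0 mR) => x mR0; field.
split=> [m /main[]//|m /main[]//|].
(* The closed formula holds from [m = 1] on, hence the shift of the index. *)
rewrite -cvg_shiftS.
have -> : (fun m => real_root_probability (P m.+1) (f m.+1)) =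
    (fun m => (Num.sqrt (m.+2%:R / (3 * m.+1%:R)))%:E).
  by apply/funext => m; have [] := main m.+1 isT.
apply: cvg_EFin; first exact: nearW.
exact: cvg_sqrt_ratio.
Qed.
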